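(* For every finitely generated non-amenable group $G$, $\mathrm{epdim}(G)=1$.
   Context: For a group $G$, $\mathcal M(G)$ denotes the set of symmetric probability measures $\mu$ on $G$ ($\mu(g)=\mu(g^{-1})$). For $\mu\in\mathcal M(G)$ and $\lambda>0$, $G^\mu(\lambda)$ is the random multigraph with vertex set $G$ in which the number of parallel edges between distinct $g,h$ is an independent Poisson random variable with mean $\lambda\mu(g^{-1}h)$; $\lambda_c(\mu):=\sup\{\lambda : \Pr(G^\mu(\lambda)\text{ has an infinite component})=0\}$ (always $\lambda_c(\mu)\ge1$). Fix a finite generating set and let $|g|$ be the word length. For $r\in(0,1)$ and $s\in(0,1]$ let ${}_e\mathcal M_s^r(G):=\{\mu\in\mathcal M(G) : \mu(g)<r^{|g|^s}\ \forall g\in G\}$. The exponential percolation dimension is $\mathrm{epdim}(G):=\sup\{s : \exists r\in(0,1) \text{ such that } \inf_{\mu\in{}_e\mathcal M_s^r(G)}\lambda_c(\mu)=1\}$, i.e. the supremum of those $s$ for which, for some $r$, there is a sequence $\mu_i\in{}_e\mathcal M_s^r(G)$ with $\lambda_c(\mu_i)\to1$. It does not depend on the choice of generating set. *)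

(* Defs.v *)
From HB Require Import structures.
From mathcomp Require Import all_boot all_order all_algebra.
From mathcomp Require Import all_classical all_reals all_analysis.
Set Implicit Arguments.
Unset Strict Implicit.
Unset Printing Implicit Defensive.
Import Order.TTheory GRing.Theory Num.Theory.
Local Open Scope classical_set_scope.
Local Open Scope ring_scope.

Definition word_prod (G : groupType) (w : seq G) : G :=
  foldr (fun x y => (x * y)%g) 1%g w.

Definition is_word_of (G : groupType) (S : seq G) (n : nat) (g : G) : Prop :=
  exists w : seq G, [/\ size w = n,
    all (fun x => (x \in S) || ((x^-1)%g \in S)) w & word_prod w = g].

Definition generates (G : groupType) (S : seq G) : Prop :=
  forall g : G, exists n, is_word_of S n g.

Lemma word_len_ex (G : groupType) (S : seq G) (g : G) :
  (exists n, is_word_of S n g) -> exists n, `[< is_word_of S n g >].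
Proof. by move=> [n Hn]; exists n; apply/asboolP. Qed.

(* word length |g| w.r.t. S: least length of a word representing g
   (set to 0 if g is not in the generated subgroup; irrelevant when S
   generates G) *)
Definition word_length (G : groupType) (S : seq G) (g : G) : nat :=
  match pselect (exists n, is_word_of S n g) with
  | left H => ex_minn (word_len_ex H)
  | right _ => 0%N
  end.

Definition amenable (R : realType) (G : groupType) : Prop :=
  exists m : set G -> R,
    [/\ m setT = 1,
        forall A, 0 <= m A,
        forall A B, A `&` B = set0 -> m (A `|` B) = m A + m B &
        forall (g : G) A, m [set (g * x)%g | x in A] = m A].

Definition sym_prob (R : realType) (G : groupType) (mu : G -> R) : Prop :=
  [/\ forall g, 0 <= mu g,
      (\esum_(g in [set: G]) (mu g)%:E = 1)%E &
      forall g, mu g = mu (g^-1)%g].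

Definition eM (R : realType) (G : groupType) (S : seq G) (r s : R)
  : set (G -> R) :=
  [set mu | sym_prob mu /\
            forall g, mu g < r `^ ((word_length S g)%:R `^ s)].

(* Poisson probability mass with mean m >= 0 (mass 1 at 0 when m = 0) *)
Definition poisson_mass (R : realType) (m : R) (k : nat) : R :=
  m ^+ k / k`!%:R * expR (- m).

(* N : G -> G -> T -> nat is a realisation, on the probability space
   (T, P), of the random multigraph G^mu(lambda): N g h is the number of
   parallel edges between g and h (only g <> h is used); the N g h for
   distinct unordered pairs {g,h} are independent Poisson variables with
   mean lambda * mu (g^-1 h). *)
Definition poisson_multigraph (R : realType) (G : groupType)
  (d : measure_display) (T : measurableType d) (P : probability T R)
  (mu : G -> R) (lambda : R) (N : G -> G -> T -> nat) : Prop :=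
  [/\ forall g h t, N g h t = N h g t,
      forall g h k, measurable [set t | N g h t = k],
      forall g h k, g != h ->
        P [set t | N g h t = k] = (poisson_mass (lambda * mu (g^-1 * h)%g) k)%:E &
      forall (s : seq (G * G)) (k : nat -> nat),
        (forall i, (i < size s)%N -> (nth (1,1)%g s i).1 != (nth (1,1)%g s i).2) ->
        (forall i j, (i < j)%N -> (j < size s)%N ->
           nth (1,1)%g s i <> nth (1,1)%g s j /\
           nth (1,1)%g s i <> ((nth (1,1)%g s j).2, (nth (1,1)%g s j).1)) ->
        P (\bigcap_(i in [set i | (i < size s)%N])
              [set t | N (nth (1,1)%g s i).1 (nth (1,1)%g s i).2 t = k i])
        = (\prod_(i < size s)
              P [set t | N (nth (1,1)%g s i).1 (nth (1,1)%g s i).2 t = k i])%E].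

Inductive reach (V : Type) (adj : V -> V -> Prop) (v : V) : V -> Prop :=
| reach_refl : reach adj v v
| reach_step w u : reach adj v w -> adj w u -> reach adj v u.

Definition mg_adj (G : groupType) (T : Type) (N : G -> G -> T -> nat) (t : T)
  (g h : G) : Prop := g <> h /\ (0 < N g h t)%N.

Definition infinite_component (G : groupType) (T : Type)
  (N : G -> G -> T -> nat) : set T :=
  [set t | exists v : G, ~ finite_set [set w | reach (mg_adj N t) v w]].

Definition lambda_c (R : realType) (G : groupType) (mu : G -> R) : \bar R :=
  ereal_sup [set l%:E | l in
    [set l : R | 0 < l /\
      forall (d : measure_display) (T : measurableType d)
             (P : probability T R) (N : G -> G -> T -> nat),
        poisson_multigraph P mu l N -> P (infinite_component N) = 0%E]].

Definition epdim (R : realType) (G : groupType) (S : seq G) : R :=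
  sup [set s : R | 0 < s <= 1 /\
        exists r : R, 0 < r < 1 /\
          ereal_inf [set lambda_c mu | mu in eM S r s] = 1%E].

(* Main.v *)
(* Non-amenability gives a linear isoperimetric inequality for right
   multiplication by the generators: otherwise an ultrafilter limit of
   counting measures on inverses of bad sets would be an invariant mean.  By
   Cheeger's argument the lazy random walk operator P then contracts l^2 by
   some k < 1, so mu = P^{2n} delta_1 satisfies
   sum_{g, h in K} mu(g^-1 h) <= k^n |K| for every finite K; in particular
   mu(g) <= k^n, and mu lives on the ball of radius 2n, whence
   mu(g) < r^{|g|} as soon as k < r^2.  In G^mu(l) almost all of the mass of
   each finite set K crosses its boundary, and exploring the cluster of 1 edge
   by edge is a branching-like process of mean nearly l: for l > 1 and n large
   the cluster is infinite with positive probability.  Conversely a union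
   bound over simple paths gives lambda_c(mu) >= 1 for every mu. *)
Require Import Defs.
From HB Require Import structures.
From mathcomp Require Import all_boot all_order all_algebra.
From mathcomp Require Import all_classical all_reals all_analysis.
From mathcomp Require Import ring lra zify.
Set Implicit Arguments.
Unset Strict Implicit.
Unset Printing Implicit Defensive.
Import Order.TTheory GRing.Theory Num.Theory.
Import numFieldNormedType.Exports.
Local Open Scope classical_set_scope.
Local Open Scope ring_scope.

(** * Isoperimetry of non-amenable groups *)

(** The rate [r] must be fixed before the precision [e]. It depends only on [k]: taking more steps
    makes [k ^+ n] small, while the requirement [k ^+ n < r ^+ (n + n)] survives for every positive
    [n]. Two obstacles shape the percolation half. First, [lambda_c] quantifies over all
    realisations, so excluding a value [l] requires building an actual Poisson multigraph; without
    one, [l] would qualify vacuously. Second, a cluster can run back into itself, so it is not a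
    branching process. Instead of a coupling, the law of the exploration is reweighted by x to the
    number of open edges. If every finite K satisfies E[x^(open boundary edges)] <= x^|K|, the
    cluster is finite with probability at most x, just as extinction has probability at most x when
    the offspring generating function f satisfies f(x) <= x. The explored set can have any shape,
    which is why the isoperimetric inequality is proved for all finite K. *)

Definition letters (G : groupType) (S : seq G) : seq G :=
  S ++ [seq (x^-1)%g | x <- S].

Lemma mem_letters (G : groupType) (S : seq G) (x : G) :
  (x \in letters S) = (x \in S) || ((x^-1)%g \in S).
Proof.
rewrite mem_cat; congr (_ || _); apply/mapP/idP => [[y yS ->]|xS].
  by rewrite invgK.
by exists (x^-1)%g => //; rewrite invgK.
Qed.

Lemma letters_inv (G : groupType) (S : seq G) (x : G) :
  ((x^-1)%g \in letters S) = (x \in letters S).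
Proof. by rewrite !mem_letters invgK orbC. Qed.

Lemma mem_ltrans (G : groupType) (g y : G) (A : set G) :
  [set (g * x)%g | x in A] y <-> A (g^-1 * y)%g.
Proof.
split=> [[x Ax <-]|Ay]; first by rewrite mulKg.
by exists (g^-1 * y)%g => //; rewrite mulVKg.
Qed.

Lemma ltrans_mul (G : groupType) (g h : G) (A : set G) :
  [set (g * h * x)%g | x in A] =
  [set (g * x)%g | x in [set (h * x)%g | x in A]].
Proof.
by apply/seteqP; split=> y; rewrite !mem_ltrans invgM -!mulgA.
Qed.

(** The letters are closed under inversion, so the one-sided inequality for s and for s^-1 together
    gives equality; invariance then passes to all words. *)
Lemma amenable_of_letters (R : realType) (G : groupType) (S : seq G)
    (m : set G -> R) : generates S ->
  m setT = 1 -> (forall A, 0 <= m A) ->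
  (forall A B, A `&` B = set0 -> m (A `|` B) = m A + m B) ->
  (forall s A, s \in letters S -> m [set (s * x)%g | x in A] <= m A) ->
  amenable R G.
Proof.
move=> gS m1 m0 mD mle; exists m; split=> // g A.
have ms s B : s \in letters S -> m [set (s * x)%g | x in B] = m B.
  move=> sS; apply/eqP; rewrite eq_le mle//=.
  have /(mle _ [set (s * x)%g | x in B]) : (s^-1)%g \in letters S by rewrite letters_inv.
  rewrite -ltrans_mul mulVg; congr (m _ <= _).
  by apply/seteqP; split=> y; rewrite mem_ltrans invg1 mul1g.
have [n [w [_ wS <-]]] := gS g; elim: w wS A => [|s w IH] /=.
  move=> _ A; congr m.
  by apply/seteqP; split=> y; rewrite mem_ltrans invg1 mul1g.
by move=> /andP[sS wS] A; rewrite ltrans_mul ms ?IH// mem_letters.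
Qed.

(** The inverse turns right multiplication, in which expansion is stated, into the left
    multiplication under which a mean must be invariant. *)
Definition density (R : realType) (G : groupType) (F : seq G) (A : set G) : R :=
  (count (fun x => `[< A (x^-1)%g >]) F)%:R / (size F)%:R.

Lemma density_01 (R : realType) (G : groupType) (F : seq G) (A : set G) :
  0 <= density R F A <= 1.
Proof.
rewrite /density divr_ge0//=; case: F => [|x F]; first by rewrite invr0 mulr0.
by rewrite ler_pdivrMr ?ltr0n// mul1r ler_nat count_size.
Qed.

(** The points that stay in [F] are moved injectively by x -> x s to points of [F] satisfying [a];
    only boundary points are lost. *)
Lemma count_shift (G : groupType) (F : seq G) (s : G) (a : pred G) : uniq F ->
  (count (fun x => a (x * s)%g) F <=
   count a F + count (fun x => (x * s)%g \notin F) F)%N.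
Proof.
move=> uF.
have split_count (p b : pred G) r :
    count p r = (count (fun x => p x && b x) r + count (fun x => p x && ~~ b x) r)%N.
  elim: r => //= x r ->.
  by case: (p x); case: (b x) => /=; lia.
rewrite (split_count (fun x => a (x * s)%g) (fun x => (x * s)%g \in F)).
apply: leq_add; last by apply: sub_count => x /= /andP[].
rewrite -!size_filter -(size_map (fun x => (x * s)%g)).
apply: uniq_leq_size.
  rewrite map_inj_uniq ?filter_uniq//; exact: mulIg.
move=> y /mapP[x]; rewrite !mem_filter => /andP[/andP[ax xs] xF] ->.
by rewrite ax.
Qed.

Lemma ultra_pushforward (T V : Type) (f : T -> V) (U : set_system T) :
  UltraFilter U -> UltraFilter (f @ U).
Proof.
move=> UU; split=> [|H PH sUH].
  by apply: fmap_proper_filter; exact: ultra_proper.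
apply/seteqP; split=> // A HA.
have [//|UnA] := in_ultra_setVsetC (f @^-1` A) UU.
have : H (A `&` ~` A) by apply: filterI => //; exact: sUH.
by rewrite setICr => H0; have := @filter_not_empty _ H PH H0.
Qed.

Lemma ultra_cvg_01 (R : realType) (U : set_system nat) (a : nat -> R) :
  UltraFilter U -> (forall n, 0 <= a n <= 1) -> cvg (a n @[n --> U]).
Proof.
move=> UU a01.
have := @segment_compact R 0 1; rewrite compact_ultra => /(_ (a n @[n --> U])).
case=> //.
  exact: ultra_pushforward.
  have : U (a @^-1` `[0, 1]) by apply: filterE => n; rewrite /= in_itv /=; exact: a01.
  by [].
by move=> p [_ Hp]; apply/cvg_ex; exists p.
Qed.

Lemma nonamenable_expansion (R : realType) (G : groupType) (S : seq G) :
  generates S -> ~ amenable R G ->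
  exists2 c : R, 0 < c & forall F : seq G, uniq F ->
    c * (size F)%:R <=
    \sum_(s <- letters S) (count (fun x => (x * s)%g \notin F) F)%:R.
Proof.
move=> gS nA; apply: contrapT => nE; apply: nA.
have {nE} /choice[F HF] (n : nat) : exists F : seq G, uniq F /\
   \sum_(s <- letters S) (count (fun x => (x * s)%g \notin F) F)%:R
     < n.+1%:R^-1 * (size F)%:R :> R.
  apply: contrapT => nF; apply: nE; exists n.+1%:R^-1; first by rewrite invr_gt0.
  move=> F uF; rewrite leNgt; apply/negP => lt; apply: nF; by exists F.
have F0 n : (0 < size (F n))%N.
  have [_] := HF n; case: (size _) => //; rewrite mulr0 => /lt_geF/negbT/negP[].
  by rewrite sumr_ge0.
(* An ultrafilter makes the densities of all sets converge at once, with additive limits. *)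
have [U [UU sU]] := ultraFilterLemma (eventually_filter : ProperFilter \oo).
pose a A n := density R (F n) A.
have ca A : cvg (a A n @[n --> U]).
  by apply: ultra_cvg_01 => n; exact: density_01.
have PU : ProperFilter U by exact: ultra_proper.
pose m A := lim (a A n @[n --> U]).
have limN : harmonic n @[n --> U] --> (0 : R).
  move=> A HA; exact: (sU _ (@cvg_harmonic R A HA)).
have climN : cvg ((harmonic n : R) @[n --> U]) by apply/cvg_ex; exists 0.
apply: (@amenable_of_letters R G S m gS).
- rewrite /m /a /density.
  have -> : (fun n => (count (fun x => `[< [set: G] (x^-1)%g >]) (F n))%:R / (size (F n))%:R : R) = fun=> 1.
    apply/funext => n; rewrite (@eq_count _ _ predT) ?count_predT; last first.
      by move=> x; apply/asboolP.
    by rewrite divff// pnatr_eq0 -lt0n.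
  exact: lim_cst.
- move=> A; apply: limr_ge; first exact: ca.
  by apply: nearW => n; have /andP[] := density_01 R (F n) A.
- move=> A B AB.
  suff aD : (fun n => a (A `|` B) n) = (fun n => a A n + a B n) by rewrite /m aD limD.
  apply/funext => n /=; rewrite /a /density -mulrDl -natrD; congr (_%:R / _).
  rewrite -count_predUI [X in (_ + X)%N](@eq_count _ _ pred0) ?count_pred0 ?addn0.
    by apply: eq_count => x /=; rewrite asbool_or.
  move=> x /=; apply/negP => /andP[/asboolP Ax /asboolP Bx].
  by have : (A `&` B) (x^-1)%g by []; rewrite AB.
(* Shifting by [s] raises the density by at most the boundary proportion of [F n], which is below
   1/(n+1) and so vanishes along [U]. *)
- move=> s A sS; rewrite /m -[leRHS]addr0.
  rewrite -(cvg_lim _ (limN))// -limD//.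
  apply: ler_lim => //; first exact: is_cvgD.
  apply: nearW => n /=; rewrite /a /density.
  have s0 : 0 < (size (F n))%:R :> R by rewrite ltr0n.
  rewrite ler_pdivrMr// mulrDl divfK ?gt_eqF//.
  have [uF lt] := HF n.
  have : (count (fun x => `[< [set (s * x)%g | x in A] x^-1%g >]) (F n) <=
     count (fun x => `[< A (x^-1)%g >]) (F n) + count (fun x => (x * s)%g \notin F n) (F n))%N.
    apply: leq_trans (count_shift s _ uF); apply: eq_leq; apply: eq_count => x.
    by apply: asbool_equiv_eq; have := mem_ltrans s (x^-1)%g A; rewrite invgM.
  rewrite -(ler_nat R) natrD => /le_trans; apply; rewrite lerD2l.
  apply: le_trans (ltW lt).
  rewrite (perm_big _ (perm_to_rem sS)) big_cons/= lerDl.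
  by rewrite sumr_ge0.
Qed.

(** * Cheeger's inequality *)

Definition fsup (R : realType) (G : groupType) (f : G -> R) :=
  exists s : seq G, forall x, x \notin s -> f x = 0.

(** By convention this sum is 0 on infinite supports, hence the recurring hypothesis [fsup]. *)
Definition gsum (R : realType) (G : groupType) (f : G -> R) : R :=
  \sum_(x \in [set: G]) f x.

Lemma sumr_cst_seq (R : pzRingType) (I : Type) (L : seq I) (a : R) :
  \sum_(i <- L) a = (size L)%:R * a.
Proof. by rewrite big_const_seq count_predT iter_addr_0 mulr_natl. Qed.

Section group_sums.
Variables (R : realType) (G : groupType).
Implicit Types (f g h : G -> R) (s L : seq G).

Lemma gsumE f s : uniq s -> (forall x, x \notin s -> f x = 0) ->
  gsum f = \sum_(x <- s) f x.
Proof.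
move=> us f0; rewrite /gsum (fsbigE s)//; last by move=> x _; exact: f0.
by apply: eq_bigl => x; rewrite mem_set.
Qed.

Lemma fsup_sub2 h f g : fsup f -> fsup g ->
  (forall x, f x = 0 -> g x = 0 -> h x = 0) -> fsup h.
Proof.
move=> [s fs] [t gt] H; exists (s ++ t) => x.
by rewrite mem_cat negb_or => /andP[xs xt]; rewrite H ?fs ?gt.
Qed.

Lemma fsup_sub h f : fsup f -> (forall x, f x = 0 -> h x = 0) -> fsup h.
Proof. by move=> ff H; apply: (fsup_sub2 ff ff) => x f0 _; exact: H. Qed.

Lemma fsup_common f g : fsup f -> fsup g -> exists s, [/\ uniq s,
  forall x, x \notin s -> f x = 0 & forall x, x \notin s -> g x = 0].
Proof.
move=> [s fs] [t gt]; exists (undup (s ++ t)); split; first exact: undup_uniq.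
  by move=> x; rewrite mem_undup mem_cat negb_or => /andP[/fs].
by move=> x; rewrite mem_undup mem_cat negb_or => /andP[_ /gt].
Qed.

Lemma gsumD f g : fsup f -> fsup g ->
  gsum (fun x => f x + g x) = gsum f + gsum g.
Proof.
move=> ff gg; have [s [us fs gs]] := fsup_common ff gg.
rewrite (gsumE us fs) (gsumE us gs) -big_split; apply: gsumE => // x xs.
by rewrite fs// gs// addr0.
Qed.

Lemma gsumZ a f : gsum (fun x => a * f x) = a * gsum f.
Proof. by rewrite /gsum mulr_fsumr. Qed.

Lemma ler_gsum f g : fsup f -> fsup g -> (forall x, f x <= g x) ->
  gsum f <= gsum g.
Proof.
move=> ff gg fg; have [s [us fs gs]] := fsup_common ff gg.
by rewrite (gsumE us fs) (gsumE us gs) ler_sum.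
Qed.

Lemma gsum_ge0 f : (forall x, 0 <= f x) -> 0 <= gsum f.
Proof. by move=> f0; rewrite /gsum fsumr_ge0. Qed.

Lemma eq_gsum f g : f =1 g -> gsum f = gsum g.
Proof. by move=> /funext ->. Qed.

Lemma gsum_shift a f : gsum (fun x => f (x * a)%g) = gsum f.
Proof.
rewrite /gsum [RHS](reindex_fsbigT (fun x => (x * a)%g))//.
by exists (fun x => (x * a^-1)%g) => x; rewrite ?mulgK ?mulgVK.
Qed.

Lemma fsup_shift a f : fsup f -> fsup (fun x => f (x * a)%g).
Proof.
move=> [s fs]; exists [seq (x * a^-1)%g | x <- s] => x xs; apply: fs.
apply: contra xs => xs; apply/mapP; exists (x * a)%g => //.
by rewrite mulgK.
Qed.

Lemma fsup_sum (I : Type) (L : seq I) (F : I -> G -> R) :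
  (forall i, fsup (F i)) -> fsup (fun x => \sum_(i <- L) F i x).
Proof.
move=> fF; elim: L => [|i L IH]; first by exists [::] => x _; rewrite big_nil.
apply: (fsup_sub2 (fF i) IH) => x Fi Fs.
by rewrite big_cons Fi Fs addr0.
Qed.

Lemma gsum_sum (I : Type) (L : seq I) (F : I -> G -> R) :
  (forall i, fsup (F i)) ->
  gsum (fun x => \sum_(i <- L) F i x) = \sum_(i <- L) gsum (F i).
Proof.
move=> fF; elim: L => [|i L IH].
  by rewrite big_nil /gsum fsbig1// => x _; rewrite big_nil.
rewrite big_cons -IH -gsumD//; last exact: fsup_sum.
by apply: eq_gsum => x; rewrite big_cons.
Qed.

Lemma seq_argmin (u : G -> R) (x : G) s :
  exists2 y, y \in x :: s & forall z, z \in x :: s -> u y <= u z.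
Proof.
elim: s x => [|a s IH] x.
  by exists x; rewrite ?mem_head// => z; rewrite inE => /eqP ->.
have [y ys ymin] := IH a.
have [xy|yx] := leP (u x) (u y).
  exists x; rewrite ?mem_head// => z; rewrite inE => /predU1P[->//|zs].
  by rewrite (le_trans xy)// ymin.
exists y; first by rewrite inE ys orbT.
by move=> z; rewrite inE => /predU1P[->|/ymin//]; exact: ltW.
Qed.

(* Layer cake: subtracting from [u] its least value on the support splits both
   sides additively and shrinks the support. *)
Lemma l1_expansion (c : R) L u :
  (forall F : seq G, uniq F -> c * (size F)%:R <=
    \sum_(s <- L) (count (fun x => (x * s)%g \notin F) F)%:R) ->
  fsup u -> (forall x, 0 <= u x) ->
  c * gsum u <= \sum_(s <- L) gsum (fun x => `|u (x * s)%g - u x|).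
Proof.
move=> cF [s]; have : uniq (undup s) by exact: undup_uniq.
move=> us us0; have {us0} : forall x, x \notin undup s -> u x = 0.
  by move=> x; rewrite mem_undup; exact: us0.
move: (undup s) us => {}s us us0 u0.
have [n] := ubnP (size s); elim: n s u us us0 u0 => // n IH s u us us0 u0 sn.
have [/hasP[x xs /eqP ux0]|] := boolP (has (fun x => u x == 0) s).
  apply: (IH (rem x s)) => //; first exact: rem_uniq.
    move=> y; rewrite mem_rem_uniq// inE negb_and negbK => /orP[/eqP->//|].
    exact: us0.
  rewrite size_rem//; case: s xs sn {us us0} => //= y s _; lia.
move=> /hasPn upos.
case: s us us0 sn upos => [|x s] us us0 sn upos.
  rewrite (gsumE us us0) big_nil mulr0.
  by apply: sumr_ge0 => i _; apply: gsum_ge0.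
have [y ys ymin] := seq_argmin u x s.
move: (x :: s) us us0 sn upos ys ymin => {x}{}s us us0 sn upos ys ymin.
pose ind x : R := (x \in s)%:R.
pose v x := u x - u y * ind x.
have find : fsup ind by exists s => x /negbTE xs; rewrite /ind xs.
have fu : fsup u by exists s.
have fv : fsup v.
  by apply: (fsup_sub2 fu find) => x; rewrite /v => -> ->; rewrite mulr0 subrr.
have v0 x : 0 <= v x.
  rewrite /v /ind; case: (boolP (x \in s)) => [/ymin|_].
    by rewrite mulr1 subr_ge0.
  by rewrite mulr0 subr0.
have vs x : x \notin rem y s -> v x = 0.
  rewrite mem_rem_uniq// inE negb_and negbK /v /ind => /orP[/eqP->|xs].
    by rewrite ys mulr1 subrr.
  by rewrite us0// (negbTE xs) mulr0 subrr.
have {}IH : c * gsum v <= \sum_(a <- L) gsum (fun x => `|v (x * a)%g - v x|).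
  apply: (IH (rem y s)) => //; first exact: rem_uniq.
  rewrite size_rem//; case: s ys sn {us us0 ind v find fv v0 vs upos ymin} => //= z s _; lia.
have fabs (w : G -> R) (a : G) : fsup w -> fsup (fun x => `|w (x * a)%g - w x|).
  by move=> fw; apply: (fsup_sub2 fw (fsup_shift a fw)) => x -> ->; rewrite subrr normr0.
have split_u x : u x = u y * ind x + v x by rewrite /v addrC subrK.
(* No cancellation occurs: where [ind] jumps, [v] vanishes on the side outside [s] and is
   nonnegative on the other, so both differences have the same sign. *)
have split_d a x : `|u (x * a)%g - u x| =
    u y * `|ind (x * a)%g - ind x| + `|v (x * a)%g - v x|.
  have := v0 x; have := v0 (x * a)%g; rewrite /v /ind.
  case: (boolP (x \in s)) => xs; case: (boolP ((x * a)%g \in s)) => xas;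
   rewrite ?mulr1 ?mulr0 ?subr0 ?sub0r ?subrr ?normr0 ?normrN ?normr1 ?mulr0 ?mulr1 ?add0r.
  - by move=> _ _; congr `| _ |; ring.
  - rewrite us0// !sub0r !normrN => _ h; rewrite (ger0_norm (u0 x)) ger0_norm//; ring.
  - rewrite (us0 _ xs) ?subr0 => h _; rewrite (ger0_norm (u0 _)) ger0_norm//; ring.
  - by [].
rewrite (eq_gsum split_u) gsumD//; last first.
  by apply: (fsup_sub find) => x ->; rewrite mulr0.
rewrite gsumZ mulrDr.
have sum_d a : gsum (fun x => `|u (x * a)%g - u x|) =
    u y * gsum (fun x => `|ind (x * a)%g - ind x|) + gsum (fun x => `|v (x * a)%g - v x|).
  rewrite (eq_gsum (split_d a)) gsumD ?gsumZ//; last exact: fabs.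
  by apply: (fsup_sub (fabs _ a find)) => x ->; rewrite mulr0.
rewrite (eq_bigr _ (fun a _ => sum_d a)).
rewrite big_split /=; apply: lerD => //.
rewrite mulrCA -mulr_sumr; apply: ler_wpM2l; first exact: u0.
have -> : gsum ind = (size s)%:R.
  rewrite (gsumE us) => [|x /negbTE xs]; last by rewrite /ind xs.
  rewrite -sum1_size natr_sum; apply: eq_big_seq => x xs.
  by rewrite /ind xs.
apply: le_trans (cF s us) _; apply: ler_sum => a _.
pose out x : R := ((x \in s) && ((x * a)%g \notin s))%:R.
have -> : (count (fun x => (x * a)%g \notin s) s)%:R = gsum out.
  rewrite (gsumE us) => [|x /negbTE xs]; last by rewrite /out xs.
  rewrite -sum1_count natr_sum big_mkcond; apply: eq_big_seq => x xs.
  by rewrite /out xs /=; case: (_ \notin _).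
apply: ler_gsum; [|exact: fabs|].
  by exists s => x /negbTE xs; rewrite /out xs.
move=> x; rewrite /out /ind; case: (x \in s); last by rewrite /= normr_ge0.
by case: (_ \in s); rewrite /= ?subrr ?normr0// sub0r normrN normr1.
Qed.

(** The l^1 inequality is applied to f^2, and |p^2 - q^2| = |p - q||p + q| is split by a weighted
    AM-GM inequality. This keeps everything linear in the sums, with no square root as in
    Cauchy-Schwarz. *)
Lemma cheeger (c : R) L f : 0 < c ->
  (forall F : seq G, uniq F -> c * (size F)%:R <=
    \sum_(s <- L) (count (fun x => (x * s)%g \notin F) F)%:R) ->
  (0 < size L)%N -> fsup f ->
  \sum_(s <- L) gsum (fun x => f (x * s)%g * f x) <=
    ((size L)%:R - c ^+ 2 / (8 * (size L)%:R)) * gsum (fun x => f x ^+ 2).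
Proof.
move=> c0 cF L0 ff; set M : R := (size L)%:R; set E := gsum _.
have M0 : 0 < M by rewrite ltr0n.
set B := \sum_(s <- L) _.
have f2 : fsup (fun x => f x ^+ 2) by apply: (fsup_sub ff) => x ->; rewrite expr0n.
have ffs a : fsup (fun x => f (x * a)%g) by exact: fsup_shift.
have H0 : c * E <= \sum_(s <- L) gsum (fun x => `|f (x * s)%g ^+ 2 - f x ^+ 2|).
  by apply: l1_expansion => // x; exact: sqr_ge0.
(* The argument yields M E - B >= (t c - 2 t^2 M) E; this [t] maximises the right side, with value
   c^2 / (8 M) times E. *)
pose t := c / (4 * M).
have t0 : 0 < t by rewrite divr_gt0// mulr_gt0.
have {}H0 : c * E <= \sum_(s <- L) (t^-1 * (E - gsum (fun x => f (x * s)%g * f x)) + 2 * t * E).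
  apply: le_trans H0 _; apply: ler_sum => a _.
  have Es : gsum (fun x => f (x * a)%g ^+ 2) = E.
    exact: (gsum_shift a (fun x => f x ^+ 2)).
  have -> : t^-1 * (E - gsum (fun x => f (x * a)%g * f x)) + 2 * t * E =
    gsum (fun x => (t^-1 / 2 + t) * f (x * a)%g ^+ 2
      + ((t^-1 / 2 + t) * f x ^+ 2 + (- t^-1) * (f (x * a)%g * f x))).
    rewrite gsumD ?gsumD ?gsumZ ?Es -/E.
    - field; exact: lt0r_neq0.
    - by apply: (fsup_sub ff) => x ->; rewrite expr0n mulr0.
    - by apply: (fsup_sub ff) => x ->; rewrite !mulr0.
    - by apply: (fsup_sub (ffs a)) => x ->; rewrite expr0n mulr0.
    - by apply: (fsup_sub ff) => x ->; rewrite expr0n !mulr0 addr0.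
  apply: ler_gsum.
  - by apply: (fsup_sub2 ff (ffs a)) => x -> ->; rewrite subrr normr0.
  - by apply: (fsup_sub2 ff (ffs a)) => x -> ->; rewrite expr0n !mulr0 !addr0.
  move=> x; set p := f (x * a)%g; set q := f x.
  (* AM-GM on the two factors of [p^2 - q^2], with ratio [t] *)
  have amgm (z : R) : z = p - q \/ z = q - p -> z * (p + q) <=
      t^-1 / 2 * (p - q) ^+ 2 + t / 2 * (p + q) ^+ 2.
    move=> zpq; have : 0 <= t^-1 / 2 * (z - t * (p + q)) ^+ 2.
      by rewrite mulr_ge0 ?sqr_ge0// divr_ge0// invr_ge0 ltW.
    have -> : t^-1 / 2 * (z - t * (p + q)) ^+ 2 =
      t^-1 / 2 * z ^+ 2 + t / 2 * (p + q) ^+ 2 - z * (p + q).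
      field; exact: lt0r_neq0.
    have -> : z ^+ 2 = (p - q) ^+ 2 by case: zpq => ->; ring.
    lra.
  have bound : t^-1 / 2 * (p - q) ^+ 2 + t / 2 * (p + q) ^+ 2 <=
      (t^-1 / 2 + t) * p ^+ 2 + ((t^-1 / 2 + t) * q ^+ 2 - t^-1 * (p * q)).
    have : 0 <= t / 2 * (p - q) ^+ 2 by rewrite mulr_ge0 ?sqr_ge0// divr_ge0// ltW.
    have -> : (t^-1 / 2 + t) * p ^+ 2 + ((t^-1 / 2 + t) * q ^+ 2 - t^-1 * (p * q)) =
      t^-1 / 2 * (p - q) ^+ 2 + t / 2 * (p + q) ^+ 2 + t / 2 * (p - q) ^+ 2.
      field; exact: lt0r_neq0.
    lra.
  rewrite mulNr; apply: le_trans bound; rewrite ler_norml.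
  have h1 := amgm (p - q) (or_introl erefl).
  have h2 := amgm (q - p) (or_intror erefl).
  have e1 : (p - q) * (p + q) = p ^+ 2 - q ^+ 2 by ring.
  have e2 : (q - p) * (p + q) = - (p ^+ 2 - q ^+ 2) by ring.
  by rewrite e1 in h1; rewrite e2 in h2; apply/andP; split; lra.
have sumE : \sum_(s <- L) (t^-1 * (E - gsum (fun x => f (x * s)%g * f x)) + 2 * t * E) =
    t^-1 * (M * E - B) + 2 * t * M * E.
  by rewrite big_split /= -mulr_sumr sumrB !sumr_cst_seq -/B; ring.
rewrite sumE in H0.
have : t * (c * E) <= t * (t^-1 * (M * E - B) + 2 * t * M * E) by rewrite ler_pM2l.
have -> : t * (t^-1 * (M * E - B) + 2 * t * M * E) = M * E - B + 2 * t ^+ 2 * M * E.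
  field; exact: lt0r_neq0.
have -> : (M - c ^+ 2 / (8 * M)) * E = M * E - t * (c * E) + 2 * t ^+ 2 * M * E.
  by rewrite /t; field; exact: lt0r_neq0.
lra.
Qed.

End group_sums.

(** * The lazy random walk *)

Lemma sqr_sum_le (R : realFieldType) (I : Type) (L : seq I) (a : I -> R) :
  (\sum_(i <- L) a i) ^+ 2 <= (size L)%:R * \sum_(i <- L) a i ^+ 2.
Proof.
case: L => [|i0 L]; first by rewrite !big_nil expr0n mul0r.
set K := i0 :: L; set n : R := (size K)%:R; set s := \sum_(i <- K) _.
have n0 : 0 < n by rewrite ltr0n.
have : 0 <= \sum_(i <- K) (a i - s / n) ^+ 2 by apply: sumr_ge0 => i _; exact: sqr_ge0.
have -> : \sum_(i <- K) (a i - s / n) ^+ 2 = \sum_(i <- K) a i ^+ 2 - s ^+ 2 / n.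
  under eq_bigr => i _ do rewrite sqrrB -addrA.
  rewrite big_split /= big_split /= sumr_cst_seq -/n.
  have -> : \sum_(i <- K) - (a i * (s / n) *+ 2) = - (2 * (s / n)) * s.
    by rewrite /s mulr_sumr; apply: eq_bigr => i _; ring.
  by field; exact: lt0r_neq0.
by rewrite subr_ge0 ler_pdivrMr// mulrC.
Qed.

(** Cheeger's inequality bounds the averaging operator only from above, so its spectrum might still
    approach -1; averaging it with the identity removes that end. *)
Definition lazy_step (R : realType) (G : groupType) (L : seq G) (f : G -> R)
  (x : G) : R := (f x + (size L)%:R^-1 * \sum_(s <- L) f (x * s)%g) / 2.

Definition dirac1 (R : realType) (G : groupType) (g x : G) : R := (x == g)%:R.

Section lazy_walk.
Variables (R : realType) (G : groupType) (L : seq G).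
Implicit Types f g : G -> R.
Local Notation P := (@lazy_step R G L).

Lemma stepE f x :
  P f x = (f x + (size L)%:R^-1 * \sum_(s <- L) f (x * s)%g) / 2.
Proof. by []. Qed.

Lemma fsup_avg f : fsup f ->
  fsup (fun x => (size L)%:R^-1 * \sum_(s <- L) f (x * s)%g).
Proof.
move=> ff; apply: (fsup_sub (fsup_sum L (fun s => fsup_shift s ff))) => x ->.
by rewrite mulr0.
Qed.

Lemma fsup_step f : fsup f -> fsup (P f).
Proof.
move=> ff; apply: (fsup_sub2 ff (fsup_avg ff)) => x.
by rewrite stepE => -> ->; rewrite addr0 mul0r.
Qed.

Lemma fsup_walk n f : fsup f -> fsup (iter n P f).
Proof. by move=> ff; elim: n => //= n; exact: fsup_step. Qed.

Lemma fsup_dirac1 (g : G) : fsup (@dirac1 R G g).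
Proof. by exists [:: g] => x; rewrite inE /dirac1 => /negbTE ->. Qed.

Lemma step_ge0 f : (forall x, 0 <= f x) -> forall x, 0 <= P f x.
Proof.
move=> f0 x; rewrite divr_ge0// addr_ge0// mulr_ge0 ?invr_ge0//.
by apply: sumr_ge0.
Qed.

Lemma walk_ge0 n f : (forall x, 0 <= f x) -> forall x, 0 <= iter n P f x.
Proof. by move=> f0; elim: n => //= n; exact: step_ge0. Qed.

Lemma walk_sum n (I : Type) (K : seq I) (F : I -> G -> R) x :
  iter n P (fun x => \sum_(i <- K) F i x) x = \sum_(i <- K) iter n P (F i) x.
Proof.
elim: n x => //= n IH x; rewrite !stepE.
under [in LHS]eq_bigr => s _ do rewrite IH.
rewrite IH; under [RHS]eq_bigr => i _ do rewrite stepE.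
by rewrite -mulr_suml big_split -mulr_sumr [in RHS]exchange_big.
Qed.

(** Steps multiply on the right, so the walk commutes with left translations. *)
Lemma walk_translate n f (h x : G) :
  iter n P (fun y => f (h * y)%g) x = iter n P f (h * x)%g.
Proof.
elim: n x => //= n IH x; rewrite !stepE IH.
by under eq_bigr => s _ do rewrite IH mulgA.
Qed.

Lemma gsum_step f : (0 < size L)%N -> fsup f -> gsum (P f) = gsum f.
Proof.
move=> L0 ff; have M0 : (size L)%:R != 0 :> R by rewrite pnatr_eq0 -lt0n.
transitivity (gsum (fun x => 2^-1 * (f x + (size L)%:R^-1 * \sum_(s <- L) f (x * s)%g))).
  by apply: eq_gsum => x; rewrite stepE mulrC.
rewrite gsumZ gsumD//; last exact: fsup_avg.
rewrite gsumZ gsum_sum => [|s]; last exact: fsup_shift.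
under eq_bigr => s _ do rewrite gsum_shift.
rewrite sumr_cst_seq mulKf//.
by field.
Qed.

Lemma gsum_walk n f : (0 < size L)%N -> fsup f -> gsum (iter n P f) = gsum f.
Proof.
move=> L0 ff; elim: n => //= n IH; rewrite gsum_step//; exact: fsup_walk.
Qed.

Lemma fsup_mul f g : fsup f -> fsup (fun x => f x * g x).
Proof. by move=> ff; apply: (fsup_sub ff) => x ->; rewrite mul0r. Qed.

Lemma gsum_mul_step f g : fsup f -> gsum (fun x => P f x * g x) =
  2^-1 * (gsum (fun x => f x * g x) +
    (size L)%:R^-1 * \sum_(s <- L) gsum (fun x => f (x * s)%g * g x)).
Proof.
move=> ff.
rewrite -gsum_sum => [|s]; last by apply: fsup_mul; exact: fsup_shift.
rewrite -gsumZ -gsumD.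
- rewrite -gsumZ; apply: eq_gsum => x.
  by rewrite stepE -mulr_suml; ring.
- exact: fsup_mul.
- apply: (fsup_sub (fsup_sum L (fun s => fsup_mul g (fsup_shift s ff)))) => x ->.
  by rewrite mulr0.
Qed.

(** Moving the shift by s to the other factor turns it into a shift by s^-1, and [L] is invariant
    under inversion, multiplicities included. *)
Lemma step_adjoint f g : perm_eq [seq (s^-1)%g | s <- L] L -> fsup f -> fsup g ->
  gsum (fun x => P f x * g x) = gsum (fun x => f x * P g x).
Proof.
move=> symL ff fg; rewrite gsum_mul_step//.
have -> : gsum (fun x => f x * P g x) = gsum (fun x => P g x * f x).
  by apply: eq_gsum => x; rewrite mulrC.
rewrite gsum_mul_step//; congr (_ * (_ + _ * _)).
  by apply: eq_gsum => x; rewrite mulrC.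
rewrite -(perm_big _ symL) big_map; apply: eq_bigr => s _.
rewrite -(gsum_shift s); apply: eq_gsum => x.
by rewrite mulgK mulrC.
Qed.

Lemma walk_adjoint n f g : perm_eq [seq (s^-1)%g | s <- L] L -> fsup f -> fsup g ->
  gsum (fun x => iter n P f x * g x) = gsum (fun x => f x * iter n P g x).
Proof.
move=> symL; elim: n f g => //= n IH f g ff fg.
rewrite step_adjoint//; last exact: fsup_walk.
rewrite IH//; last exact: fsup_step.
by under [RHS]eq_gsum => x do rewrite -iterS iterSr.
Qed.

Lemma gsum_dirac1 (g : G) f : gsum (fun x => dirac1 R g x * f x) = f g.
Proof.
rewrite (@gsumE _ _ _ [:: g])// => [|x].
  by rewrite big_seq1 /dirac1 eqxx mul1r.
by rewrite inE /dirac1 => /negbTE ->; rewrite mul0r.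
Qed.

Lemma dirac1_translate (g x : G) : dirac1 R 1%g (g^-1 * x)%g = dirac1 R g x.
Proof.
rewrite /dirac1; congr (nat_of_bool _)%:R; apply/eqP/eqP => [gx|->].
  by rewrite -(mulVKg g x) gx mulg1.
by rewrite mulVg.
Qed.

Lemma walk_dirac1_translate n (g x : G) :
  iter n P (dirac1 R g) x = iter n P (dirac1 R 1%g) (g^-1 * x)%g.
Proof.
rewrite -walk_translate; congr (iter n P _ x); apply/funext => y.
by rewrite dirac1_translate.
Qed.

Lemma walk_sym n (g : G) : perm_eq [seq (s^-1)%g | s <- L] L ->
  iter n P (dirac1 R 1%g) g = iter n P (dirac1 R 1%g) (g^-1)%g.
Proof.
move=> symL; rewrite -[LHS]gsum_dirac1 -walk_adjoint//; try exact: fsup_dirac1.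
rewrite -[in RHS](mulg1 (g^-1)%g) -walk_dirac1_translate -[RHS]gsum_dirac1.
by apply: eq_gsum => x; rewrite mulrC.
Qed.

(** With Q the averaging operator, |P f|^2 = (|f|^2 + 2 <Q f, f> + |Q f|^2) / 4. The last term is at
    most |f|^2; Cheeger's gain c^2 / (8 M^2) in the middle one is halved by its weight. *)
Lemma step_contract (c : R) f : 0 < c ->
  (forall F : seq G, uniq F -> c * (size F)%:R <=
    \sum_(s <- L) (count (fun x => (x * s)%g \notin F) F)%:R) ->
  (0 < size L)%N -> fsup f ->
  gsum (fun x => P f x ^+ 2) <=
    (1 - c ^+ 2 / (16 * (size L)%:R ^+ 2)) * gsum (fun x => f x ^+ 2).
Proof.
move=> c0 cF L0 ff; have M0 : 0 < (size L)%:R :> R by rewrite ltr0n.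
have chg := cheeger c0 cF L0 ff.
set M := (size L)%:R in chg M0 *; set E := gsum _ in chg *.
set B := \sum_(s <- L) _ in chg.
pose q x := M^-1 * \sum_(s <- L) f (x * s)%g.
have fq : fsup q by exact: fsup_avg.
have f2 (h : G -> R) : fsup h -> fsup (fun x => h x ^+ 2).
  by move=> fh; apply: (fsup_sub fh) => x ->; rewrite expr0n.
have q2 : gsum (fun x => q x ^+ 2) <= E.
  have -> : E = gsum (fun x => M^-1 * \sum_(s <- L) f (x * s)%g ^+ 2).
    rewrite gsumZ gsum_sum => [|s]; last by apply: f2; exact: fsup_shift.
    under eq_bigr => s _ do rewrite (gsum_shift s (fun x => f x ^+ 2)).
    by rewrite sumr_cst_seq mulKf// lt0r_neq0.
  apply: ler_gsum; [exact: f2| |].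
    apply: (fsup_sub (fsup_sum L (fun s => f2 _ (fsup_shift s ff)))) => x ->.
    by rewrite mulr0.
  move=> x; rewrite /q exprMn expr2 -mulrA ler_pM2l ?invr_gt0//.
  by rewrite ler_pdivrMl// sqr_sum_le.
have qf : gsum (fun x => q x * f x) = M^-1 * B.
  rewrite /B -gsum_sum => [|s]; last by apply: fsup_mul; exact: fsup_shift.
  by rewrite -gsumZ; apply: eq_gsum => x; rewrite /q -mulrA mulr_suml.
have -> : gsum (fun x => P f x ^+ 2) = 4^-1 * (E + (2 * (M^-1 * B) + gsum (fun x => q x ^+ 2))).
  rewrite -qf -gsumZ -gsumD; [|by apply: (fsup_sub fq) => x ->; rewrite mul0r mulr0|exact: f2].
  rewrite -gsumD; [|exact: f2|by apply: (fsup_sub fq) => x ->; rewrite expr0n mul0r mulr0 addr0].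
  by rewrite -gsumZ; apply: eq_gsum => x; rewrite stepE -/M -/(q x); field.
have : M^-1 * B <= M^-1 * ((M - c ^+ 2 / (8 * M)) * E) by rewrite ler_pM2l ?invr_gt0.
have -> : M^-1 * ((M - c ^+ 2 / (8 * M)) * E) = E - c ^+ 2 / (8 * M ^+ 2) * E.
  by field; exact: lt0r_neq0.
have -> : (1 - c ^+ 2 / (16 * M ^+ 2)) * E = E - c ^+ 2 / (8 * M ^+ 2) * E / 2.
  by field; exact: lt0r_neq0.
lra.
Qed.

Lemma walk_contract (k : R) n f : 0 <= k ->
  (forall f, fsup f -> gsum (fun x => P f x ^+ 2) <= k * gsum (fun x => f x ^+ 2)) ->
  fsup f -> gsum (fun x => iter n P f x ^+ 2) <= k ^+ n * gsum (fun x => f x ^+ 2).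
Proof.
move=> k0 kP ff; elim: n => [|n IH]; first by rewrite mul1r.
apply: le_trans (kP _ (fsup_walk n ff)) _.
by rewrite exprS -mulrA ler_wpM2l.
Qed.

(** The double sum is <1_K, P^(2n) 1_K> = |P^n 1_K|^2 by self-adjointness, hence the even number of
    steps. As [k] contracts squared norms, the exponent is [n]. *)
Lemma walk_pairs (k : R) n (K : seq G) : perm_eq [seq (s^-1)%g | s <- L] L ->
  0 <= k ->
  (forall f, fsup f -> gsum (fun x => P f x ^+ 2) <= k * gsum (fun x => f x ^+ 2)) ->
  uniq K ->
  \sum_(g <- K) \sum_(h <- K) iter (n + n) P (dirac1 R 1%g) (g^-1 * h)%g <=
    k ^+ n * (size K)%:R.
Proof.
move=> symL k0 kP uK.
pose ind x : R := \sum_(g <- K) dirac1 R g x.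
have indE x : ind x = (x \in K)%:R.
  rewrite /ind /dirac1 -natr_sum; congr _%:R.
  rewrite -(count_uniq_mem x uK) -sum1_count [RHS]big_mkcond /=.
  by apply: eq_bigr => g _; rewrite eq_sym; case: (_ == _).
have find : fsup ind by exists K => x /negbTE xK; rewrite indE xK.
have gind (h : G -> R) : gsum (fun x => ind x * h x) = \sum_(x <- K) h x.
  rewrite (gsumE uK) => [|x /negbTE xK]; last by rewrite indE xK mul0r.
  by apply: eq_big_seq => x xK; rewrite indE xK mul1r.
rewrite exchange_big /=.
under eq_bigr => h _.
  under eq_bigr => g _ do rewrite -walk_dirac1_translate.
  rewrite -walk_sum.
  over.
rewrite -gind.
have -> : gsum (fun x => ind x * iter (n + n) P ind x) =
    gsum (fun x => iter n P ind x ^+ 2).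
  under eq_gsum => x do rewrite iterD.
  by rewrite -walk_adjoint//; exact: fsup_walk.
apply: le_trans (walk_contract n k0 kP find) _.
rewrite (eq_gsum (g := fun x => ind x * ind x))// gind.
have -> : \sum_(x <- K) ind x = (size K)%:R => //.
by rewrite -sum1_size natr_sum; apply: eq_big_seq => x xK; rewrite indE xK.
Qed.

End lazy_walk.

(** * From the walk to measures with exponential decay *)

Lemma word_prod_cat (G : groupType) (v w : seq G) :
  word_prod (v ++ w) = (word_prod v * word_prod w)%g.
Proof. by elim: v => [|x v IH] /=; rewrite ?mul1g// IH mulgA. Qed.

Lemma word_length_le (G : groupType) (S : seq G) n (g : G) :
  is_word_of S n g -> (word_length S g <= n)%N.
Proof.
move=> gn; rewrite /word_length; case: pselect => // H.
by case: ex_minnP => m _; apply; apply/asboolP.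
Qed.

Lemma walk_support (R : realType) (G : groupType) (S : seq G) n (g : G) :
  iter n (@lazy_step R G (letters S)) (dirac1 R 1%g) g != 0 ->
  exists2 k, (k <= n)%N & is_word_of S k g.
Proof.
elim: n g => [|n IH] g /=.
  rewrite /dirac1; case: (g =P 1%g) => [-> _|_]; last by rewrite eqxx.
  by exists 0%N => //; exists [::].
rewrite stepE; set w := iter _ _ _ in IH *.
have [/IH[k kn gk]|] := boolP (w g != 0); first by exists k => //; exact: leqW.
rewrite negbK => /eqP -> wn.
have /hasP[s sS ws] : has (fun s => w (g * s)%g != 0) (letters S).
  apply: contraNT wn => /hasPn ws; rewrite add0r big_seq big1 ?mulr0 ?mul0r// => s /ws.
  by rewrite negbK => /eqP.
have [k kn [v [vk vS vg]]] := IH _ ws.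
exists k.+1 => //; exists (v ++ [:: (s^-1)%g]); split.
- by rewrite size_cat vk addn1.
- by rewrite all_cat vS /= andbT -mem_letters letters_inv.
- by rewrite word_prod_cat vg /= mulg1 mulgK.
Qed.

Lemma esum_fsup (R : realType) (G : groupType) (f : G -> R) :
  fsup f -> (forall x, 0 <= f x) ->
  (\esum_(g in [set: G]) (f g)%:E = (gsum f)%:E)%E.
Proof.
move=> [t ft] f0.
have ud : forall x, x \notin undup t -> f x = 0 by move=> x; rewrite mem_undup; exact: ft.
rewrite (gsumE (undup_uniq t) ud).
have -> : (\esum_(g in [set: G]) (f g)%:E =
    \esum_(g in [set` undup t]) (f g)%:E)%E.
  rewrite [RHS]esum_mkcond; apply: eq_esum => x _; case: ifPn => // /negP xt.
  by rewrite ud//; apply/negP => xt'; apply: xt; rewrite inE.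
rewrite esum_fset; [|exact: finite_seq|by move=> x _; rewrite lee_fin].
by rewrite -fsbig_seq ?undup_uniq// sumEFin.
Qed.

Lemma letters_perm_inv (G : groupType) (S : seq G) :
  perm_eq [seq (s^-1)%g | s <- letters S] (letters S).
Proof.
rewrite /letters map_cat mapK; last exact: invgK.
by rewrite perm_catC.
Qed.

Lemma small_isoperimetric_measures (R : realType) (G : groupType) (S : seq G) :
  generates S -> ~ amenable R G ->
  exists2 r : R, 0 < r < 1 & forall e : R, 0 < e -> exists mu : G -> R,
    [/\ eM S r 1 mu, fsup mu, forall g, mu g <= e & forall K : seq G, uniq K ->
      \sum_(g <- K) \sum_(h <- K) mu (g^-1 * h)%g <= e * (size K)%:R].
Proof.
move=> gS nA; have [c c0 cF] := nonamenable_expansion gS nA.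
have symL := letters_perm_inv S.
set L := letters S in cF symL.
(* With no letters, expansion of the set {1} would read c <= 0. *)
have L0 : (0 < size L)%N.
  case: L cF {symL} => // /(_ [:: 1%g] isT).
  by rewrite big_nil mulr1 leNgt c0.
pose k : R := 1 - c ^+ 2 / (16 * (size L)%:R ^+ 2).
have M0 : 0 < (size L)%:R :> R by rewrite ltr0n.
have kP (f : G -> R) (ff : fsup f) : gsum (fun x => lazy_step L f x ^+ 2) <= k * gsum (fun x => f x ^+ 2).
  exact: step_contract.
have k1 : k < 1 by rewrite /k gtrBl divr_gt0 ?mulr_gt0 ?exprn_gt0.
have k0 : 0 <= k.
  have := kP _ (fsup_dirac1 R 1%g).
  have -> : gsum (fun x : G => dirac1 R 1%g x ^+ 2) = 1.
    rewrite (eq_gsum (g := fun x => dirac1 R 1%g x * dirac1 R 1%g x))// gsum_dirac1.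
    by rewrite /dirac1 eqxx.
  by rewrite mulr1; apply: le_trans; apply: gsum_ge0 => x; exact: sqr_ge0.
(* Here r^2 - k = (1 - k)^2 / 4 > 0. *)
pose r : R := (1 + k) / 2.
have r0 : 0 < r by rewrite divr_gt0// ltr_wpDr.
have r1 : r < 1 by rewrite /r; lra.
have kr : k < r ^+ 2.
  have : 0 < (1 - k) ^+ 2 by rewrite exprn_gt0// subr_gt0.
  have -> : r ^+ 2 = k + (1 - k) ^+ 2 / 4 by rewrite /r; field.
  by lra.
exists r; first by rewrite r0.
move=> e e0.
(* Positivity of [n] makes [k ^+ n < r ^+ (n + n)] strict. *)
have [n n0 ne] : exists2 n, (0 < n)%N & k ^+ n <= e.
  have : (geometric 1 k : nat -> R) @ \oo --> (0 : R).
    by apply: cvg_geometric; rewrite ger0_norm.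
  move=> /cvgrPdist_le/(_ e e0)[N _ HN]; exists N.+1 => //.
  have := HN N.+1 (leqnSn N); rewrite /geometric /= mul1r sub0r normrN ger0_norm//.
  exact: exprn_ge0.
pose mu g := iter (n + n) (@lazy_step R G L) (dirac1 R 1%g) g.
have d0 x : 0 <= dirac1 R (1 : G)%g x by rewrite /dirac1.
have mu0 g : 0 <= mu g by exact: walk_ge0.
have fmu : fsup mu by apply: fsup_walk; exact: fsup_dirac1.
have pairs (K : seq G) : uniq K ->
    \sum_(g <- K) \sum_(h <- K) mu (g^-1 * h)%g <= k ^+ n * (size K)%:R.
  exact: walk_pairs.
(* For K = {1, g} the double sum is 2 mu(1) + 2 mu(g) by symmetry, against the bound 2 k^n. *)
have muk g : mu g <= k ^+ n.
  have [->|g1] := eqVneq g 1%g.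
    have := pairs [:: 1%g] isT.
    by rewrite !big_seq1 mulr1 mulVg.
  have := pairs [:: 1%g; g]; rewrite /= inE eq_sym g1 => /(_ isT).
  rewrite !big_cons !big_nil !addr0 !mulVg invg1 mul1g mulg1.
  rewrite -[mu (g^-1)%g]walk_sym// -/(mu g).
  by have := mu0 1%g; lra.
exists mu; split=> //; first last.
- by move=> K uK; apply: le_trans (pairs K uK) _; rewrite ler_wpM2r.
- by move=> g; exact: le_trans (muk g) ne.
split; first split=> //.
- rewrite esum_fsup// /mu gsum_walk//; last exact: fsup_dirac1.
  have -> : gsum (dirac1 R (1 : G)%g) = gsum (fun x : G => dirac1 R 1%g x * 1).
    by apply: eq_gsum => x; rewrite mulr1.
  by rewrite gsum_dirac1.
- by move=> g; exact: walk_sym.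
move=> g; rewrite powRr1// powR_mulrn ?(ltW r0)//.
have [->|mug] := eqVneq (mu g) 0; first exact: exprn_gt0.
have [j jn gj] := walk_support mug.
apply: le_lt_trans (muk g) _; apply: (@lt_le_trans _ _ (r ^+ (n + n))).
  by rewrite addnn -mul2n exprM ltrXn2r -?lt0n.
rewrite ler_wiXn2l ?(ltW r0) ?(ltW r1)//.
exact: leq_trans (word_length_le gj) jn.
Qed.

(** * Cluster events of a Poisson multigraph *)

(** Countability of [G], through words over finitely many letters. It serves both measurability of
    cluster events and the indexing of the independent variables. *)
Lemma generates_code (G : groupType) (S : seq G) : generates S ->
  exists (code : G -> nat) (dec : nat -> G), cancel code dec.
Proof.
move=> gS; pose L := letters S.
pose dec j := word_prod [seq nth 1%g L i | i <- odflt [::] (@unpickle (seq nat) j)].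
have /choice[code codeK] : forall g : G, exists j, dec j = g.
  move=> g; have [n [w [_ wS <-]]] := gS g.
  exists (pickle [seq index x L | x <- w]); rewrite /dec pickleK /= -map_comp.
  congr word_prod; rewrite -[RHS]map_id; apply/eq_in_map => x xw /=.
  by rewrite nth_index// mem_letters (allP wS).
by exists code, dec.
Qed.

Definition edge_swap (V : Type) (e : V * V) := (e.2, e.1).

(** Being duplicate-free together with the reversals excludes loops, repetitions and opposite
    orientations at once, as the independence clause of [poisson_multigraph] requires. *)
Definition simple_edges (V : eqType) (s : seq (V * V)) :=
  uniq (s ++ map (@edge_swap V) s).

Lemma simple_edges_perm (V : eqType) (s t : seq (V * V)) :
  perm_eq s t -> simple_edges s = simple_edges t.
Proof.
move=> st; apply: perm_uniq.
by apply: perm_cat => //; exact: perm_map.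
Qed.

Lemma edge_swapK (V : Type) : involutive (@edge_swap V).
Proof. by case. Qed.

Lemma mem_edge_swap (V : eqType) (s : seq (V * V)) e :
  (e \in map (@edge_swap V) s) = (edge_swap e \in s).
Proof.
by rewrite -{1}[e]edge_swapK mem_map//; exact: inv_inj (@edge_swapK V).
Qed.

Lemma simple_edges_cons (V : eqType) (e : V * V) s :
  simple_edges (e :: s) =
  [&& e.1 != e.2, e \notin s, edge_swap e \notin s & simple_edges s].
Proof.
have swap_eq : (e == edge_swap e) = (e.1 == e.2).
  by case: e => a b; rewrite /edge_swap xpair_eqE /= [b == a]eq_sym andbb.
have perm_es : perm_eq ((e :: s) ++ map (@edge_swap V) (e :: s))
    (e :: edge_swap e :: s ++ map (@edge_swap V) s).
  by rewrite /= perm_cons -cat1s perm_catCA.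
rewrite /simple_edges (perm_uniq perm_es) /= inE !mem_cat !mem_edge_swap edge_swapK.
rewrite swap_eq !negb_or.
by case: (e.1 == _); case: (e \in s); case: (_ \in s).
Qed.

Lemma simple_edges_neq (V : eqType) (s : seq (V * V)) x0 i : simple_edges s ->
  (i < size s)%N -> (nth x0 s i).1 != (nth x0 s i).2.
Proof.
elim: s i => //= e s IH [|i]; rewrite simple_edges_cons => /and4P[ne _ _ us] //=.
exact: IH.
Qed.

Lemma simple_edges_pair (V : eqType) (s : seq (V * V)) x0 i j : simple_edges s ->
  (i < j)%N -> (j < size s)%N ->
  nth x0 s i <> nth x0 s j /\
  nth x0 s i <> ((nth x0 s j).2, (nth x0 s j).1).
Proof.
elim: s i j => //= e s IH i [//|j]; rewrite simple_edges_cons.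
move=> /and4P[ne es ses us]; case: i => [|i] /= ij js; last exact: IH.
have js' : nth x0 s j \in s by exact: mem_nth.
split=> ee; first by rewrite ee js' in es.
by move: ses; rewrite ee /edge_swap /= -surjective_pairing js'.
Qed.

Section multigraph.
Context (R : realType) (G : groupType) (d : measure_display)
  (T : measurableType d) (P : probability T R) (mu : G -> R) (l : R)
  (N : G -> G -> T -> nat).
Hypothesis PM : poisson_multigraph P mu l N.

Definition closed_edge (e : G * G) : set T := [set t | N e.1 e.2 t = 0%N].

Definition edge_prob (e : G * G) : R := 1 - expR (- (l * mu (e.1^-1 * e.2)%g)).

Definition edges_state (C O : seq (G * G)) : set T :=
  [set t | (forall e, e \in C -> closed_edge e t) /\
           (forall e, e \in O -> ~ closed_edge e t)].

Lemma closed_edge_measurable e : measurable (closed_edge e).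
Proof. by have [_ mN _ _] := PM; exact: mN. Qed.

Lemma edges_state_closed C O e :
  edges_state (e :: C) O = edges_state C O `&` closed_edge e.
Proof.
apply/seteqP; split=> t [cC oO].
  split; first by split=> // f fC; apply: cC; rewrite inE fC orbT.
  by apply: cC; rewrite inE eqxx.
case: cC => cC oO'; split=> // f; rewrite inE => /predU1P[->//|]; exact: cC.
Qed.

Lemma edges_state_open C O e :
  edges_state C (e :: O) = edges_state C O `\` closed_edge e.
Proof.
apply/seteqP; split=> t [cC oO].
  split; first by split=> // f fC; apply: oO; rewrite inE fC orbT.
  by apply: oO; rewrite inE eqxx.
case: cC => cC oO'; split=> // f; rewrite inE => /predU1P[->//|]; exact: oO'.
Qed.

Lemma edges_state_measurable C O : measurable (edges_state C O).
Proof.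
elim: O => [|e O IH]; last first.
  by rewrite edges_state_open; apply: measurableD => //; exact: closed_edge_measurable.
elim: C => [|e C IH]; last first.
  by rewrite edges_state_closed; apply: measurableI => //; exact: closed_edge_measurable.
rewrite (_ : edges_state _ _ = setT)//.
by apply/seteqP; split.
Qed.

Lemma edges_closed_prob C : simple_edges C ->
  P (edges_state C [::]) = (\prod_(e <- C) (1 - edge_prob e))%:E.
Proof.
move=> sC; have [_ _ Np Ni] := PM.
have := Ni C (fun=> 0%N) (fun i => @simple_edges_neq _ _ _ i sC)
  (fun i j => @simple_edges_pair _ _ _ i j sC).
set X := \bigcap_(i in _) _; have -> : X = edges_state C [::].
  apply/seteqP; split=> t Xt.
    split=> // e eC; have := Xt (index e C); rewrite /= nth_index//.
    by apply; rewrite index_mem.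
  by move=> i /= iC; have [cC _] := Xt; exact: (cC _ (mem_nth _ iC)).
move=> ->; rewrite (big_nth (1%g, 1%g)) big_mkord -prodEFin; apply: eq_bigr => i _.
rewrite Np; last exact: simple_edges_neq.
by rewrite /poisson_mass expr0 fact0 invr1 mul1r /edge_prob opprB addrC subrK mul1r.
Qed.

(** Independence is given for prescribed multiplicities, hence directly for closed edges. An open
    edge is then handled by subtracting the event where it is closed from the one where it is
    undecided. *)
Lemma edges_state_prob C O : simple_edges (C ++ O) ->
  P (edges_state C O) =
  (\prod_(e <- C) (1 - edge_prob e) * \prod_(e <- O) edge_prob e)%:E.
Proof.
elim: O C => [|e O IH] C.
  by rewrite cats0 big_nil mulr1; exact: edges_closed_prob.
have pe : perm_eq (C ++ e :: O) (e :: C ++ O) by rewrite -(cat1s e O) perm_catCA.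
rewrite (simple_edges_perm pe) => sCO.
have sCO' : simple_edges (C ++ O) by move: sCO; rewrite simple_edges_cons => /and4P[].
have : P (edges_state C O) =
    (P (edges_state C (e :: O)) + P (edges_state (e :: C) O))%E.
  rewrite edges_state_closed edges_state_open; apply: measureDI.
    exact: edges_state_measurable.
  exact: closed_edge_measurable.
rewrite !IH// big_cons [in X in _ -> X]big_cons.
rewrite mulrCA.
set q := P _; have : q \is a fin_num.
  by apply: fin_num_measure; exact: edges_state_measurable.
case: q => // q _; rewrite -EFinD => -[qE]; congr _%:E.
move: qE; set a := \prod_(_ <- C) _; set b := \prod_(_ <- O) _ => qE.
by apply: (addIr ((1 - edge_prob e) * a * b)); rewrite -qE; ring.
Qed.

Definition adj t (g h : G) := (g != h) && (0 < N g h t)%N.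

Lemma adjE t g h : adj t g h <-> mg_adj N t g h.
Proof. by split=> [/andP[/eqP]|[/eqP gh N0]]; [split|apply/andP]. Qed.

Lemma reach_path t v w : reach (mg_adj N t) v w <->
  exists p, [/\ path (adj t) v p, uniq (v :: p) & last v p = w].
Proof.
split=> [|[p [vp _ <-]]].
  elim=> [|x u _ [p [vp _ <-]]]; first by exists [::].
  move=> /adjE xu.
  have uE : last v (rcons p u) = u by rewrite last_rcons.
  have : path (adj t) v (rcons p u) by rewrite rcons_path vp.
  by move: uE => /[swap] /shortenP[q vq uq _] uE; exists q.
elim/last_ind: p vp => [_|p x IH]; first exact: reach_refl.
rewrite rcons_path last_rcons => /andP[vp px].
by apply: reach_step (IH vp) _; apply/adjE.
Qed.

Definition open_path v p : set T := [set t | path (adj t) v p].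

Lemma adj_measurable g h : measurable [set t | adj t g h].
Proof.
rewrite /adj; have [->|gh] := eqVneq g h; first by rewrite (_ : [set _ | _] = set0)//; apply/seteqP; split.
rewrite (_ : [set _ | _] = ~` closed_edge (g, h)).
  by apply: measurableC; exact: closed_edge_measurable.
by apply/seteqP; split=> t /=; rewrite lt0n => /eqP.
Qed.

Lemma open_path_measurable v p : measurable (open_path v p).
Proof.
elim: p v => [|x p IH] v; first by rewrite (_ : open_path _ _ = setT)//; apply/seteqP; split.
rewrite (_ : open_path _ _ = [set t | adj t v x] `&` open_path x p).
  by apply: measurableI; [exact: adj_measurable|exact: IH].
by apply/seteqP; split=> t => [/andP[]|[vx xp]] //; apply/andP.
Qed.

Variables (code : G -> nat) (dec : nat -> G).
Hypothesis codeK : cancel code dec.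

Definition path_code (p : seq G) : nat := pickle (map code p).
Definition path_dec (i : nat) : seq G := map dec (odflt [::] (unpickle i)).

Lemma path_codeK : cancel path_code path_dec.
Proof. by move=> p; rewrite /path_dec pickleK /= mapK. Qed.

Lemma reach_measurable v w : measurable [set t | reach (mg_adj N t) v w].
Proof.
rewrite (_ : [set _ | _] =
    \bigcup_i (if last v (path_dec i) == w then open_path v (path_dec i) else set0)).
  by apply: bigcupT_measurable => i; case: ifP => // _; exact: open_path_measurable.
apply/seteqP; split=> t /=.
  move=> /reach_path[p [vp _ vw]]; exists (path_code p) => //.
  by rewrite path_codeK vw eqxx.
move=> [i _]; case: ifP => // /eqP <-; move: (path_dec i) => p.
elim/last_ind: p => [_|p x IH]; first exact: reach_refl.
rewrite /open_path /= rcons_path last_rcons => /andP[vp px].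
by apply: reach_step (IH vp) _; apply/adjE.
Qed.

(** The condition on [j] lets each vertex occur under its own code only, so an infinite cluster
    means that infinitely many of these events occur. *)
Definition reach_code v j : set T :=
  [set t | reach (mg_adj N t) v (dec j) /\ code (dec j) = j].

Lemma reach_code_measurable v j : measurable (reach_code v j).
Proof.
have [e|ne] := eqVneq (code (dec j)) j; last first.
  by rewrite (_ : reach_code _ _ = set0)//; apply/seteqP; split=> // t [_ /eqP]; rewrite (negbTE ne).
rewrite (_ : reach_code _ _ = [set t | reach (mg_adj N t) v (dec j)]).
  exact: reach_measurable.
by apply/seteqP; split=> t => [[]|].
Qed.

Lemma infinite_clusterE v t :
  ~ finite_set [set w | reach (mg_adj N t) v w] <-> lim_sup_set (reach_code v) t.
Proof.
split=> [infC n _|limC /finite_seqP[s Cs]].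
  apply: contrapT => nF; apply: infC.
  apply: (@sub_finite_set _ _ (dec @` `I_n)); last exact: finite_image.
  move=> w /= vw; exists (code w); last exact: codeK.
  rewrite /= ltnNge; apply/negP => nw; apply: nF; exists (code w) => //.
  by split; rewrite codeK.
have [j /= nj [vj jj]] := limC (\max_(x <- s) code x).+1 I.
have : dec j \in s by have : [set` s] (dec j) by rewrite -Cs.
by move=> js; have := @leq_bigmax_seq _ s xpredT code _ js isT; rewrite jj leqNgt nj.
Qed.

Lemma infinite_componentE :
  infinite_component N = \bigcup_n lim_sup_set (reach_code (dec n)).
Proof.
apply/seteqP; split=> t.
  by move=> [v /infinite_clusterE vt]; exists (code v) => //; rewrite codeK.
by move=> [n _ /infinite_clusterE nt]; exists (dec n).
Qed.

Lemma infinite_cluster_measurable v : measurable (lim_sup_set (reach_code v)).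
Proof.
apply: bigcapT_measurable => n; apply: bigcup_measurable => j _.
exact: reach_code_measurable.
Qed.

End multigraph.

(** * Absence of percolation below 1 *)

Fixpoint path_edges (V : Type) (v : V) (p : seq V) : seq (V * V) :=
  if p is x :: q then (v, x) :: path_edges x q else [::].

Lemma path_edges_mem (V : eqType) (v : V) p e :
  e \in path_edges v p -> (e.1 \in v :: p) && (e.2 \in p).
Proof.
elim: p v => //= x p IH v; rewrite inE => /predU1P[-> /=|/IH/andP[e1 e2]].
  by rewrite !inE !eqxx.
by apply/andP; split; rewrite in_cons; apply/orP; right.
Qed.

Lemma path_edges_simple (V : eqType) (v : V) p :
  uniq (v :: p) -> simple_edges (path_edges v p).
Proof.
elim: p v => //= x p IH v /and3P[vxp xp up].
rewrite simple_edges_cons IH /= ?xp// andbT.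
move: vxp; rewrite inE negb_or => /andP[-> vp] /=; apply/andP; split.
  apply/negP => /path_edges_mem /=; rewrite inE (negbTE vp) orbF => /andP[/eqP vx xp'].
  by rewrite xp' in xp.
by apply/negP => /path_edges_mem /=; rewrite (negbTE vp) andbF.
Qed.

Fixpoint path_weight (R : realType) (V : Type) (w : V -> V -> R) v (p : seq V) : R :=
  if p is x :: q then w v x * path_weight w x q else 1.

Lemma path_weight_ge0 (R : realType) (V : Type) (w : V -> V -> R) v p :
  (forall x y, 0 <= w x y) -> 0 <= path_weight w v p.
Proof. by move=> w0; elim: p v => //= x p IH v; rewrite mulr_ge0. Qed.

Lemma edge_prob_bounds (R : realType) (G : groupType) (mu : G -> R) (l : R) e :
  (forall g, 0 <= mu g) -> 0 <= l ->
  0 <= edge_prob mu l e <= l * mu (e.1^-1 * e.2)%g.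
Proof.
move=> mu0 l0; rewrite /edge_prob; set w := l * _.
have w0 : 0 <= w by rewrite mulr_ge0.
have h1 : expR (- w) <= 1 by rewrite -expR0 ler_expR oppr_le0.
have h2 := expR_ge1Dx (- w).
by apply/andP; split; lra.
Qed.

Lemma open_path_prob (R : realType) (G : groupType) (d : measure_display)
    (T : measurableType d) (P : probability T R) (mu : G -> R) (l : R)
    (N : G -> G -> T -> nat) v p : poisson_multigraph P mu l N ->
  (forall g, 0 <= mu g) -> 0 <= l -> uniq (v :: p) ->
  (P (open_path N v p) <= (path_weight (fun g h => l * mu (g^-1 * h)%g) v p)%:E)%E.
Proof.
move=> PM mu0 l0 up.
have se := path_edges_simple up.
apply: (@le_trans _ _ (P (edges_state N [::] (path_edges v p)))).
  apply: le_measure; rewrite ?inE; [exact: (open_path_measurable PM)|exact: (edges_state_measurable PM)|].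
  move=> t; rewrite /open_path /= => vp; split=> // e {se up}.
  elim: p v vp => //= x p IH v /andP[/andP[_ vx] xp].
  rewrite inE => /predU1P[->|]; last exact: IH.
  by rewrite /closed_edge /= => vx0; rewrite vx0 in vx.
rewrite (edges_state_prob PM)// lee_fin big_nil mul1r {se up}.
elim: p v => [|x p IH] v /=; first by rewrite big_nil.
rewrite big_cons; have /andP[p0 p1] := edge_prob_bounds (v, x) mu0 l0.
apply: ler_pM => //.
by apply: prodr_ge0 => e _; have /andP[] := edge_prob_bounds e mu0 l0.
Qed.

Lemma esum_scale_le (R : realType) (I : choiceType) (D : set I) (c : R) (a : I -> \bar R) :
  0 <= c -> (forall i, 0 <= a i)%E ->
  (\esum_(i in D) (c%:E * a i) <= c%:E * \esum_(i in D) a i)%E.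
Proof.
move=> c0 a0; apply: ge_ereal_sup => _ [X [finX XD] <-].
rewrite -ge0_mule_fsumr//; apply: lee_wpmul2l; first by rewrite lee_fin.
by apply: esum_ge; exists X.
Qed.

Section subcritical.
Context (R : realType) (G : groupType) (mu : G -> R) (l : R).
Hypotheses (mu_prob : sym_prob mu) (l0 : 0 <= l).
Let w g h : R := l * mu (g^-1 * h)%g.

Let w0 g h : 0 <= w g h.
Proof. by rewrite mulr_ge0//; case: mu_prob. Qed.

Let pw0 v p : (0%:E <= (path_weight w v p)%:E)%E.
Proof. by rewrite lee_fin path_weight_ge0. Qed.

Lemma esum_step_weight v : (\esum_(x in [set: G]) (w v x)%:E <= l%:E)%E.
Proof.
have [mu0 mu1 _] := mu_prob.
rewrite /w; under eq_esum => x _ do rewrite EFinM.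
apply: le_trans (esum_scale_le _ l0 _) _; first by move=> x; rewrite lee_fin.
rewrite -[leRHS]mule1; apply: lee_wpmul2l; first by rewrite lee_fin.
rewrite -mu1 [leRHS](@reindex_esum _ _ _ [set: G] [set: G] (fun x => (v^-1 * x)%g))//.
split=> //; first by move=> x y _ _ /mulgI.
by move=> y _; exists (v * y)%g => //; rewrite mulKg.
Qed.

(** By translation every vertex sends out total weight at most [l], so each further step costs a
    factor [l]. *)
Lemma esum_path_weight_size v n :
  (\esum_(p in [set p : seq G | size p = n]) (path_weight w v p)%:E <= (l ^+ n)%:E)%E.
Proof.
elim: n v => [|n IH] v.
  rewrite (_ : [set _ | _] = [set [::]]); first by rewrite esum_set1.
  by apply/seteqP; split=> [[]|_ ->].
rewrite (@reindex_esum _ _ _ ([set: G] `*`` (fun=> [set p : seq G | size p = n])) _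
    (fun k => k.1 :: k.2)); last first.
  split.
  - by move=> [x p] [_ /= ->].
  - by move=> [x p] [y q] _ _ /= [-> ->].
  - by move=> [|x p] //= [pn]; exists (x, p).
rewrite -(@esum_esum _ _ _ _ _ (fun x p => (path_weight w v (x :: p))%:E))//.
apply: (@le_trans _ _ (\esum_(x in [set: G]) ((l ^+ n)%:E * (w v x)%:E))%E).
  apply: le_esum => x _ /=; under eq_esum => p _ do rewrite EFinM.
  apply: le_trans (esum_scale_le _ (w0 v x) (pw0 x)) _.
  rewrite muleC; apply: lee_wpmul2r; first by rewrite lee_fin.
  exact: IH.
apply: le_trans (esum_scale_le _ _ _) _; rewrite ?exprn_ge0//.
  by move=> x; rewrite lee_fin.
rewrite exprSr EFinM; apply: lee_wpmul2l; first by rewrite lee_fin exprn_ge0.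
exact: esum_step_weight.
Qed.

Hypothesis l1 : l < 1.

Lemma esum_path_weight v :
  (\esum_(p in [set: seq G]) (path_weight w v p)%:E < +oo)%E.
Proof.
rewrite (_ : [set: seq G] = \bigcup_n [set p : seq G | size p = n]); last first.
  by apply/seteqP; split=> // p _; exists (size p).
rewrite nneseries_sum_bigcup//; last first.
  by move=> i j _ _ [p [/= <- <-]].
apply: (@le_lt_trans _ _ ((1 - l)^-1)%:E); last by rewrite ltry.
apply: lime_le; first by apply: is_cvg_nneseries => n _ _; exact: esum_ge0.
apply: nearW => n.
apply: (@le_trans _ _ (\sum_(0 <= i < n) (l ^+ i)%:E)%E).
  by apply: lee_sum => i _; exact: esum_path_weight_size.
rewrite sumEFin lee_fin -[leRHS]mul1r ler_pdivlMr ?subr_gt0// big_mkord.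
have := subrX1 l n; move=> /(congr1 -%R); rewrite opprB -mulNr opprB mulrC => <-.
by rewrite gerBl exprn_ge0.
Qed.

Variables (code : G -> nat) (dec : nat -> G).
Hypothesis codeK : cancel code dec.
Context (d : measure_display) (T : measurableType d) (P : probability T R)
  (N : G -> G -> T -> nat).
Hypothesis PM : poisson_multigraph P mu l N.

Let pcode := path_code code.
Let pdec := path_dec dec.

(** Borel-Cantelli: almost surely only finitely many simple paths from [v] are open, and every
    vertex of the cluster ends one of them. *)
Lemma infinite_cluster_null v : P (lim_sup_set (reach_code N code dec v)) = 0%E.
Proof.
have [mu0 _ _] := mu_prob.
(* Keeping only canonical codes counts each path once. *)
pose H i := if (pcode (pdec i) == i) && uniq (v :: pdec i)
  then open_path N v (pdec i) else set0.
have mH i : measurable (H i).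
  by rewrite /H; case: ifP => // _; exact: (open_path_measurable PM).
have PH : (\sum_(i <oo) P (H i) < +oo)%E.
  apply: le_lt_trans (esum_path_weight v).
  have -> : (\esum_(p in [set: seq G]) (path_weight w v p)%:E =
      \esum_(i in [set i | pcode (pdec i) = i]) (path_weight w v (pdec i))%:E)%E.
    rewrite [RHS](@reindex_esum _ _ _ [set: seq G] _ pcode).
      by apply: eq_esum => p _; rewrite /pdec /pcode (path_codeK codeK).
    split.
    - by move=> p _ /=; rewrite /pdec /pcode (path_codeK codeK).
    - by move=> p q _ _; exact: (can_inj (path_codeK codeK)).
    - by move=> i /= <-; exists (pdec i).
  rewrite nneseries_esumT// [leRHS]esum_mkcond; apply: le_esum => i _.
  rewrite /H; case: ifP => [/andP[/eqP pi ui]|_]; last first.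
    by rewrite measure0; case: ifP.
  rewrite mem_set//; exact: (open_path_prob PM mu0 l0 ui).
have := lim_sup_set_cvg0 mH PH; apply: subset_measure0.
- exact: (infinite_cluster_measurable PM).
- by apply: bigcapT_measurable => n; apply: bigcup_measurable => j _.
move=> t /(infinite_clusterE N codeK) infC n _; apply: contrapT => nH; apply: infC.
apply: (@sub_finite_set _ _ ((fun i => last v (pdec i)) @` `I_n)); last exact: finite_image.
move=> x /reach_path[p [vp up px]]; exists (pcode p); last first.
  by rewrite /pdec /pcode (path_codeK codeK).
rewrite /= ltnNge; apply/negP => np; apply: nH; exists (pcode p) => //.
by rewrite /H /pdec /pcode (path_codeK codeK) eqxx up.
Qed.

Lemma infinite_component_null : P (infinite_component N) = 0%E.
Proof.
rewrite (infinite_componentE N codeK); apply/negligibleP.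
  by apply: bigcupT_measurable => n; exact: (infinite_cluster_measurable PM).
apply: negligible_bigcup => n; apply/negligibleP; last exact: infinite_cluster_null.
exact: (infinite_cluster_measurable PM).
Qed.

End subcritical.

Lemma lambda_c_ge1 (R : realType) (G : groupType) (S : seq G) (mu : G -> R) :
  generates S -> sym_prob mu -> (1%:E <= lambda_c mu)%E.
Proof.
move=> gS mu_prob; have [code [dec codeK]] := generates_code gS.
have sub (l : R) : 0 < l < 1 -> (l%:E <= lambda_c mu)%E.
  move=> /andP[l0 l1]; apply: ereal_sup_ubound; exists l => //; split=> //.
  by move=> d T P N PM; exact: (infinite_component_null mu_prob (ltW l0) l1 codeK PM).
(* Any lower bound in (0, 1) serves: it rules out -oo, so that a midpoint between [lambda_c mu] and
   1 can be taken. *)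
have h0 : (2^-1%:E <= lambda_c mu)%E by apply: sub; lra.
rewrite leNgt; apply/negP => lt1.
have : lambda_c mu \is a fin_num.
  rewrite fin_numE; apply/andP; split; apply/eqP => e; rewrite e // in h0 lt1.
case: (lambda_c mu) sub h0 lt1 => // x sub; rewrite lee_fin lte_fin => h0 lt1 _.
have : (((x + 1) / 2)%:E <= x%:E)%E by apply: sub; lra.
by rewrite lee_fin; lra.
Qed.

(** * Independent sequences on the unit interval *)

Section interval_coding.
Variable R : realType.
Implicit Types (q : nat -> R) (p : nat -> nat -> R).

Definition is_pmf q := (forall k, 0 <= q k) /\ series q @ \oo --> (1 : R).

Definition quantile q (u : R) : nat :=
  if pselect (exists k, u < series q k.+1) is left H then ex_minn H else 0%N.

(** The cell where [quantile q] equals k is an interval of length [q k]; it is mapped affinely onto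
    [0, 1), so that given the quantile the result is again uniform. *)
Definition rescale q (u : R) : R :=
  (u - series q (quantile q u)) / q (quantile q u).

(* Iterating [quantile] and [rescale] reads off from one uniform variable a
   sequence of independent variables with laws [p 0], [p 1], and so on. *)
Fixpoint coded p (n : nat) (u : R) : nat :=
  if n is m.+1 then coded (fun i => p i.+1) m (rescale (p 0%N) u)
  else quantile (p 0%N) u.

Lemma series_pmf_le1 q k : is_pmf q -> series q k <= 1.
Proof.
move=> [q0 q1]; rewrite -(cvg_lim _ q1)//; apply: nondecreasing_cvgn_le.
  by apply/nondecreasing_seqP => n; rewrite seriesSr lerDl.
by apply/cvg_ex; exists 1.
Qed.

Lemma quantileP q u k : is_pmf q -> 0 <= u < 1 ->
  quantile q u = k <-> series q k <= u < series q k.+1.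
Proof.
move=> qP /andP[u0 u1]; have [q0 q1] := qP.
have mono : {homo series q : m n / (m <= n)%N >-> m <= n}.
  by apply/nondecreasing_seqP => n; rewrite seriesSr lerDl.
have ex : exists k, u < series q k.+1.
  have /cvgrPdist_lt/(_ (1 - u))[|N _ HN] := q1; first by rewrite subr_gt0.
  exists N; have := HN N.+1 (leqnSn N) => /=.
  by rewrite ltr_norml => /andP[_]; lra.
rewrite /quantile; case: pselect => // H; case: ex_minnP => m um mmin.
split=> [<-|/andP[ku uk]].
  rewrite um andbT leNgt; apply/negP; case: m um mmin => [|m] um mmin.
    by rewrite /series /= big_geq// => /(le_lt_trans u0); rewrite ltxx.
  by move=> /mmin; rewrite ltnn.
apply/eqP; rewrite eqn_leq mmin//= leqNgt; apply/negP => mk.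
by have := lt_le_trans um (mono _ _ mk); rewrite ltNge ku.
Qed.

Lemma rescale_01 q u : is_pmf q -> 0 <= u < 1 -> 0 <= rescale q u < 1.
Proof.
move=> qP u01; have /(quantileP _ qP u01)/andP[] : quantile q u = quantile q u by [].
rewrite /rescale; set k := quantile q u; rewrite seriesSr => ku uk.
have qk : 0 < q k by lra.
by rewrite divr_ge0 ?subr_ge0 ?(ltW qk)//= ltr_pdivrMr// mul1r; lra.
Qed.

Lemma cylinderE n p (w : nat -> nat) : (forall i, is_pmf (p i)) ->
  exists a : R, [/\ 0 <= a, a + \prod_(i < n) p i (w i) <= 1 &
    [set u | 0 <= u < 1 /\ forall i, (i < n)%N -> coded p i u = w i] =
    [set` `[a, a + \prod_(i < n) p i (w i)[ ] ].
Proof.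
elim: n p w => [|n IH] p w pP.
  exists 0; rewrite big_ord0 add0r; split=> //.
  by apply/seteqP; split=> u /=; rewrite in_itv/=; [case|].
have [a [a0 al aE]] := IH (fun i => p i.+1) (fun i => w i.+1) (fun i => pP i.+1).
rewrite big_ord_recl; set l := \prod_(i < n) p i.+1 (w i.+1) in al aE.
rewrite -[\prod_(i < n) _]/l.
have [q0 _] := pP 0%N; set q := p 0%N in q0 *; set k := w 0%N.
have l0 : 0 <= l by apply: prodr_ge0 => i _; have [] := pP i.+1.
have sk := series_pmf_le1 k.+1 (pP 0%N); rewrite -/q seriesSr in sk.
have s0 : 0 <= series q k by apply: sumr_ge0.
(* A value of mass 0 has an empty cell, and [rescale] would divide by 0 there. *)
have := q0 k; rewrite le_eqVlt => /predU1P[qk0|qk].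
  exists (series q k); rewrite -qk0 mul0r addr0; split=> //.
    by rewrite (le_trans _ sk)// -qk0 addr0.
  rewrite set_itvco0.
  apply/seteqP; split=> // u [u01 /(_ 0%N isT)].
  move=> /= /(quantileP _ (pP 0%N) u01).
  by rewrite -/q -/k seriesSr -qk0 addr0 => /andP[/le_lt_trans h /h]; rewrite ltxx.
exists (series q k + q k * a); split.
- by rewrite addr_ge0// mulr_ge0.
- have : q k * (a + l) <= q k * 1 by rewrite ler_pM2l.
  by rewrite mulrDr mulr1; lra.
have memE (u : R) : [set` `[a, a + l[ ] u = (a <= u < a + l) by rewrite /= in_itv.
have itvE (u : R) : a <= (u - series q k) / q k < a + l <->
    series q k + q k * a <= u < series q k + q k * a + q k * l.
  rewrite ler_pdivlMr// ltr_pdivrMr// [a * _]mulrC [(a + l) * _]mulrC mulrDr.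
  by split=> /andP[h1 h2]; apply/andP; split; lra.
apply/seteqP; split=> u.
  move=> [u01 cu]; rewrite /= in_itv /=; apply/itvE.
  have uk : quantile q u = k by exact: (cu 0%N).
  have : [set u | 0 <= u < 1 /\ forall i, (i < n)%N ->
      coded (fun i => p i.+1) i u = w i.+1] (rescale q u).
    split; first exact: (rescale_01 (pP 0%N) u01).
    by move=> i ni; exact: (cu i.+1).
  by rewrite aE memE /rescale uk.
rewrite /= in_itv /= => /itvE h.
have u01 : 0 <= u < 1.
  move/itvE: h; have : q k * (a + l) <= q k * 1 by rewrite ler_pM2l.
  have : 0 <= q k * a by rewrite mulr_ge0.
  by rewrite mulrDr mulr1 => h1 h2 /andP[h3 h4]; apply/andP; split; lra.
have uk : quantile q u = k.
  apply/(quantileP _ (pP 0%N) u01); rewrite -/q seriesSr.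
  move/itvE: h; have : q k * (a + l) <= q k * 1 by rewrite ler_pM2l.
  have : 0 <= q k * a by rewrite mulr_ge0.
  by rewrite mulrDr mulr1 => h1 h2 /andP[h3 h4]; apply/andP; split; lra.
have := h; rewrite -memE -aE => -[_ cu]; split=> // -[|i] ni //=.
by rewrite /rescale -/q uk; exact: cu.
Qed.

Local Notation P := (uniform_prob (@ltr01 R)).

Lemma uniform_prob_itv (a b : R) : 0 <= a -> a <= b -> b <= 1 ->
  P [set` `[a, b[ ] = (b - a)%:E.
Proof.
move=> a0 ab b1; rewrite /uniform_prob.
rewrite (eq_integral (fun=> 1%:E)); last first.
  move=> x; rewrite inE /= in_itv /= => /andP[ax xb].
  by rewrite /uniform_pdf (le_trans a0 ax) (le_trans (ltW xb) b1) subr0 invr1.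
rewrite integral_cst//= ?mul1e lebesgue_measure_itv /= lte_fin.
by move: ab; rewrite le_eqVlt => /predU1P[->|->]; rewrite ?ltxx ?subrr// -EFinD.
Qed.

Definition coded_event p n (v : nat -> option nat) : set R :=
  [set u | 0 <= u < 1 /\ forall i k, (i < n)%N -> v i = Some k -> coded p i u = k].

(** Induction on a bound [m] for the unprescribed coordinates. Without any, the event is the
    interval of [cylinderE]; a free coordinate is summed over all its values, whose masses add up to
    1. *)
Lemma coded_event_prob p n m v : (forall i, is_pmf (p i)) ->
  (forall i, (m <= i < n)%N -> v i <> None) ->
  measurable (coded_event p n v : set (measurableTypeR R)) /\
  P (coded_event p n v) = (\prod_(i < n) (if v i is Some k then p i k else 1))%:E.
Proof.
move=> pP; elim: m v => [|m IH] v vS.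
  pose w i := odflt 0%N (v i).
  have vw i : (i < n)%N -> v i = Some (w i).
    by move=> ni; have := vS i ni; rewrite /w; case: (v i).
  have [a [a0 al aE]] := cylinderE n w pP.
  have -> : coded_event p n v = [set` `[a, a + \prod_(i < n) p i (w i)[ ].
    rewrite -aE; apply/seteqP; split=> u [u01 cu]; split=> // i.
      by move=> ni; apply: cu => //; exact: vw.
    by move=> k ni; rewrite vw// => -[<-]; exact: cu.
  have w0 : 0 <= \prod_(i < n) p i (w i) by apply: prodr_ge0 => i _; have [] := pP i.
  split; first exact: measurable_itv.
  rewrite uniform_prob_itv// ?lerDl// addrAC subrr add0r; congr EFin.
  by apply: eq_bigr => i _; rewrite vw.
have [nm|mn] := leqP n m.
  by apply: IH => i /andP[mi ni]; rewrite ltnNge (leq_trans nm mi) in ni.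
case vm : (v m) => [k|].
  apply: IH => i /andP[]; rewrite leq_eqVlt => /predU1P[<- _|mi ni]; first by rewrite vm.
  by apply: vS; rewrite mi.
pose vk k i := if i == m then Some k else v i.
have vkS k i : (m <= i < n)%N -> vk k i <> None.
  rewrite /vk; case: eqVneq => // im /andP[mi ni]; apply: vS.
  by rewrite ni andbT ltn_neqAle eq_sym im.
have E : coded_event p n v = \bigcup_k coded_event p n (vk k).
  apply/seteqP; split=> u.
    move=> [u01 cu]; exists (coded p m u) => //; split=> // i k ni.
    by rewrite /vk; case: eqVneq => [-> [<-]|_]; last exact: cu.
  move=> [k _ [u01 cu]]; split=> // i j ni vij; apply: cu => //.
  by rewrite /vk; case: eqVneq => // im; rewrite im vm in vij.
have mE k : measurable (coded_event p n (vk k) : set (measurableTypeR R)).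
  by have [] := IH (vk k) (vkS k).
have PE k : P (coded_event p n (vk k)) = _ := (IH (vk k) (vkS k)).2.
split; first by rewrite E; exact: bigcupT_measurable.
have tE : trivIset setT (fun k => coded_event p n (vk k)).
  move=> i j _ _ [u [[_ ci] [_ cj]]].
  by rewrite -(ci m i mn) ?(cj m j mn)// /vk eqxx.
rewrite E measure_semi_bigcup//; last exact: bigcupT_measurable.
pose rest := \prod_(i < n | i != Ordinal mn) (if v i is Some k then p i k else 1).
have -> : \prod_(i < n) (if v i is Some k then p i k else 1) = rest.
  by rewrite (bigD1 (Ordinal mn))//= vm mul1r.
have PEr k : P (coded_event p n (vk k)) = (p m k * rest)%:E.
  rewrite PE (bigD1 (Ordinal mn))//= /vk eqxx; congr (_ * _)%:E.
  apply: eq_bigr => i im; rewrite ifN//.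
rewrite (eq_eseriesr (g := fun k => (p m k * rest)%:E)); last first.
  by move=> k _; exact: PEr.
apply/cvg_lim => //.
rewrite (_ : (fun _ => _) = EFin \o (fun n => series (p m) n * rest)).
  apply: cvg_EFin; first by apply: nearW => x; rewrite fin_numE.
  rewrite -[X in _ --> X]mul1r; apply: cvgMl; have [_] := pP m; exact.
by apply/funext => N; rewrite /= /series /= sumEFin mulr_suml.
Qed.

End interval_coding.

Lemma exists_independent_sequence (R : realType) (p : nat -> nat -> R) :
  (forall i, is_pmf (p i)) ->
  exists (d : measure_display) (T : measurableType d) (P : probability T R)
    (X : nat -> T -> nat),
  (forall i k, measurable [set t | X i t = k]) /\
  forall (J : seq nat) (f : nat -> nat), uniq J ->
    P [set t | forall j, j \in J -> X j t = f j] = (\prod_(j <- J) p j (f j))%:E.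
Proof.
move=> pP; exists _, (measurableTypeR R), (uniform_prob (@ltr01 R)).
(* The sample space is the whole line; outside [0, 1), a null set, the value 0 is a dummy. *)
pose X n (u : measurableTypeR R) : nat := if (0 <= (u : R) < 1) then coded p n u else 0%N.
exists X.
pose I := [set` `[0 : R, 1[ ] : set (measurableTypeR R).
have mI : measurable I by exact: measurable_itv.
have PI : uniform_prob (@ltr01 R) (~` I) = 0%E.
  transitivity (1 - uniform_prob (@ltr01 R) I)%E; first exact: probability_setC.
  by rewrite /I uniform_prob_itv// subr0 subee.
have IE u : I u <-> 0 <= u < 1 by rewrite /I /= in_itv.
have mX i k : measurable [set t | X i t = k].
  pose v j := if j == i then Some k else None.
  have vS j : (i.+1 <= j < i.+1)%N -> v j <> None.
    by move=> /andP[ij ji]; have := leq_trans ji ij; rewrite ltnn.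
  have [mv _] := coded_event_prob pP vS.
  rewrite (_ : [set _ | _] = coded_event p i.+1 v `|` (if k == 0%N then ~` I else set0)).
    apply: measurableU => //; case: ifP => // _; exact: measurableC.
  apply/seteqP; split=> t; rewrite /X /=.
    have [t01 tk|t01 tk] := boolP (0 <= t < 1).
      by left; split=> // j m ji; rewrite /v; case: eqVneq => // -> [<-].
    by right; rewrite -tk eqxx => /IE; rewrite (negbTE t01).
  case=> [[t01 ct]|] /=; first by rewrite t01; apply: ct => //; rewrite /v eqxx.
  case: eqVneq => // -> /= nt; case: ifP => // t01; case: nt; exact/IE.
split=> // J f uJ.
pose n := (\max_(j <- J) j).+1.
have Jn j : j \in J -> (j < n)%N by move=> jJ; rewrite ltnS; exact: (@leq_bigmax_seq _ J xpredT id).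
pose v j := if j \in J then Some (f j) else None.
have vS j : (n <= j < n)%N -> v j <> None.
  by move=> /andP[nj jn]; have := leq_trans jn nj; rewrite ltnn.
have [mv Pv] := coded_event_prob pP vS.
set A := [set t | _].
have mA : measurable A.
  rewrite (_ : A = \bigcap_(j in [set` J]) [set t | X j t = f j]).
    by apply: fin_bigcap_measurable => // j _; exact: mX.
  by apply/seteqP; split.
have AI : A `&` I = coded_event p n v.
  apply/seteqP; split=> t.
    move=> [At /IE t01]; split=> // j k _; rewrite /v; case: ifP => // jJ [<-].
    by have := At j jJ; rewrite /X t01.
  move=> [t01 ct]; split; last exact/IE.
  by move=> j jJ; rewrite /X t01; apply: ct; [exact: Jn|rewrite /v jJ].
transitivity (uniform_prob (@ltr01 R) (A `&` I)).
  transitivity (uniform_prob (@ltr01 R) (A `\` I) + uniform_prob (@ltr01 R) (A `&` I))%E.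
    exact: measureDI.
  rewrite (_ : uniform_prob _ (A `\` I) = 0%E) ?add0e//.
  apply: (@subset_measure0 _ _ _ _ _ (~` I)) => //; first exact: measurableD.
  by apply: measurableC.
rewrite AI Pv; congr EFin.
rewrite -(big_mkord xpredT (fun i => if v i is Some k then p i k else 1)).
rewrite (bigID (mem J))/= [X in _ * X]big1 ?mulr1; last first.
  by move=> i /negbTE iJ; rewrite /v iJ.
rewrite -big_filter (perm_big J).
  by apply: eq_big_seq => j jJ; rewrite /v jJ.
apply: uniq_perm => //; first by rewrite filter_uniq// iota_uniq.
move=> j; rewrite mem_filter mem_index_iota /=; case jJ : (j \in J) => //=.
exact: Jn.
Qed.

(** * Existence of the Poisson multigraph *)

Lemma poisson_mass_pmf (R : realType) (m : R) : 0 <= m -> is_pmf (poisson_mass m).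
Proof.
move=> m0; split=> [k|].
  by rewrite /poisson_mass mulr_ge0 ?expR_ge0// divr_ge0// exprn_ge0.
have -> : series (poisson_mass m) = (fun n => series (exp_coeff m) n * expR (- m)).
  by apply/funext => n; rewrite /series /= mulr_suml.
have -> : 1 = expR m * expR (- m) by rewrite -expRD subrr expR0.
apply: cvgMl; rewrite /expR.
exact: (@is_cvg_series_exp_coeff R m).
Qed.

Lemma poisson_multigraph_exists (R : realType) (G : groupType) (S : seq G)
    (mu : G -> R) (l : R) : generates S -> sym_prob mu -> 0 <= l ->
  exists (d : measure_display) (T : measurableType d) (P : probability T R)
    (N : G -> G -> T -> nat), poisson_multigraph P mu l N.
Proof.
move=> gS [mu0 _ musym] l0; have [code [dec codeK]] := generates_code gS.
(* Sorting the codes gives each unordered pair one coordinate of the independent sequence; symmetry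
   of [mu] makes the mean independent of the order. *)
pose idx g h := pickle (minn (code g) (code h), maxn (code g) (code h)).
pose q (i : nat) : nat -> R :=
  let e := odflt (0%N, 0%N) (unpickle i) in
  poisson_mass (l * mu ((dec e.1)^-1 * dec e.2)%g).
have qidx g h : q (idx g h) = poisson_mass (l * mu (g^-1 * h)%g).
  rewrite /q pickleK /=; case: (leqP (code g) (code h)) => _; rewrite !codeK//.
  by rewrite musym invgM invgK.
have idxC g h : idx g h = idx h g by rewrite /idx minnC maxnC.
have idx_inj g h g' h' : idx g h = idx g' h' ->
    (g, h) = (g', h') \/ (g, h) = (h', g').
  move=> /(pcan_inj pickleK)[].
  case: (leqP (code g) (code h)) => _; case: (leqP (code g') (code h')) => _;
    by move=> /(can_inj codeK) -> /(can_inj codeK) ->; solve [by left | by right].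
have qpmf i : is_pmf (q i) by apply: poisson_mass_pmf; rewrite mulr_ge0.
have [d [T [P [X [mX PX]]]]] := exists_independent_sequence qpmf.
exists d, T, P, (fun g h => X (idx g h)).
have P1 i k : P [set t | X i t = k] = (q i k)%:E.
  have := PX [:: i] (fun=> k) isT; rewrite big_seq1 => <-; congr (P _).
  apply/seteqP; split=> t /= h; last by apply: h; rewrite mem_head.
  by move=> j; rewrite inE => /eqP ->.
split.
- by move=> g h t; rewrite idxC.
- by move=> g h k; exact: mX.
- by move=> g h k _; rewrite P1 qidx.
move=> s k _ sne.
pose J := [seq idx e.1 e.2 | e <- s].
have nthJ i : (i < size s)%N ->
    nth 0%N J i = idx (nth (1, 1)%g s i).1 (nth (1, 1)%g s i).2.
  by move=> si; rewrite (nth_map (1, 1)%g).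
have Jneq i j : (i < j)%N -> (j < size s)%N -> nth 0%N J i <> nth 0%N J j.
  move=> ij js; rewrite !nthJ//; last exact: ltn_trans ij js.
  have [n1 n2] := sne i j ij js.
  by move=> /idx_inj; rewrite -!surjective_pairing => -[].
have uJ : uniq J.
  apply/(uniqP 0%N) => i j; rewrite !inE size_map => si sj ij.
  by case: (ltngtP i j) => // h; [case: (Jneq i j)|case: (Jneq j i)].
have -> : \bigcap_(i in [set i | (i < size s)%N])
    [set t | X (idx (nth (1, 1)%g s i).1 (nth (1, 1)%g s i).2) t = k i] =
    [set t | forall j, j \in J -> X j t = k (index j J)].
  apply/seteqP; split=> t h.
    move=> j jJ; have jJ' := jJ; rewrite -index_mem size_map in jJ'.
    by have := h _ jJ'; rewrite /= -nthJ// nth_index.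
  move=> i /= si; rewrite -nthJ// h; last by rewrite mem_nth// size_map.
  by rewrite index_uniq// size_map.
rewrite PX// (big_nth 0%N) big_mkord size_map -prodEFin; apply: eq_bigr => i _.
by rewrite P1 -nthJ// index_uniq// size_map.
Qed.

(** * Exploration of a cluster *)

(** [Z] will be a finite set carrying [mu], which keeps the boundary a finite list. Edges are
    directed out of [K], so none appears in both orientations. *)
Definition edge_boundary (G : groupType) (Z K : seq G) : seq (G * G) :=
  [seq e <- [seq (g, (g * z)%g) | g <- K, z <- Z] | e.2 \notin K].

Lemma mem_edge_boundary (G : groupType) (Z K : seq G) e :
  e \in edge_boundary Z K -> (e.1 \in K) && (e.2 \notin K).
Proof.
rewrite mem_filter => /andP[e2 /allpairsP[[g z] [/= gK _ eE]]].
by rewrite e2 eE gK.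
Qed.

Lemma edge_boundary_uniq (G : groupType) (Z K : seq G) :
  uniq Z -> uniq K -> uniq (edge_boundary Z K).
Proof.
move=> uZ uK; apply: filter_uniq; apply: allpairs_uniq => //.
by move=> [g z] [g' z'] _ _ /= [-> /mulgI ->].
Qed.

Section exploration.
Context (R : realType) (G : groupType) (mu : G -> R) (l : R) (Z : seq G).
Context (d : measure_display) (T : measurableType d) (P : probability T R)
  (N : G -> G -> T -> nat).
Hypotheses (PM : poisson_multigraph P mu l N) (mu0 : forall g, 0 <= mu g)
  (l0 : 0 <= l) (uZ : uniq Z).
Variables (code : G -> nat) (dec : nat -> G).
Hypothesis codeK : cancel code dec.
Variable x : R.
Hypotheses (x0 : 0 < x) (x1 : x < 1).

Let p e := edge_prob mu l e.
(** The generating function at [x] of the indicator that [e] is open: q e = (1 - p e) + x p e. *)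
Let q e := 1 - (1 - x) * p e.

Hypothesis boundary : forall K : seq G, uniq K ->
  \prod_(e <- edge_boundary Z K) q e <= x ^+ size K.

Let p0 e : 0 <= p e.
Proof. by have /andP[] := edge_prob_bounds e mu0 l0. Qed.

Let p1 e : p e < 1.
Proof. by rewrite /p /edge_prob gtrBl expR_gt0. Qed.

Let q0 e : 0 < q e.
Proof.
rewrite subr_gt0; apply: (@le_lt_trans _ _ ((1 - x) * 1)).
  by rewrite ler_pM2l ?subr_gt0// ltW.
by rewrite mulr1 gtrBl.
Qed.

Let q1 e : q e <= 1.
Proof. by rewrite /q gerBl mulr_ge0// subr_ge0 ltW. Qed.

(** The law of the state of [e] reweighted by [x] when open; division by [q e] makes it a
    probability again. *)
Let closed_tilt e := (1 - p e) / q e.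
Let open_tilt e := x * p e / q e.

Let tilt_sum e : closed_tilt e + open_tilt e = 1.
Proof.
rewrite /closed_tilt /open_tilt -mulrDl -[RHS](@divff _ (q e)) ?lt0r_neq0// /q.
by congr (_ / _); ring.
Qed.

Let closed_tilt0 e : 0 <= closed_tilt e.
Proof. by rewrite divr_ge0 ?(ltW (q0 _))// subr_ge0 ltW. Qed.

Let open_tilt0 e : 0 <= open_tilt e.
Proof. by rewrite divr_ge0 ?(ltW (q0 _))// mulr_ge0// ltW. Qed.

Let prod_q_le (C D : seq (G * G)) : uniq C -> uniq D -> {subset D <= C} ->
  \prod_(e <- C) q e <= \prod_(e <- D) q e.
Proof.
move=> uC uD DC; rewrite (bigID (mem D))/=.
have -> : \prod_(e <- C | e \in D) q e = \prod_(e <- D) q e.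
  rewrite -big_filter; apply: perm_big; apply: uniq_perm => //.
    exact: filter_uniq.
  by move=> e; rewrite mem_filter; case eD : (e \in D) => //=; exact: DC.
rewrite ler_piMr//; first by apply: prodr_ge0 => e _; exact: ltW.
by apply: prodr_ile1 => e _; rewrite ltW//= q1.
Qed.

Variable v : G.
(** Every vertex of the cluster has code below [n]; in particular there are at most [n] of them,
    which makes the exploration terminate. *)
Let confined n : set T := ~` \bigcup_(j >= n) reach_code N code dec v j.

Lemma confined_measurable n : measurable (confined n).
Proof.
by apply: measurableC; apply: bigcup_measurable => j _; exact: (reach_code_measurable PM).
Qed.

(* State of an exploration of the cluster of [v]: [A] is the set of vertices
   found so far, [C] and [O] the edges examined and found closed, resp. open. *)
Definition exploration (A : seq G) (C O : seq (G * G)) :=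
  [/\ uniq A, size A = (size O).+1, simple_edges (C ++ O) &
   [/\ forall e, e \in C -> e.1 \in A,
       forall e, e \in O -> e.1 \in A /\ e.2 \in A &
       forall t, edges_state N C O t ->
         forall a, a \in A -> reach (mg_adj N t) v a]].

Lemma exploration_closed A C O e : exploration A C O ->
  e.1 \in A -> e.2 \notin A -> e \notin C -> exploration A (e :: C) O.
Proof.
move=> [uA sA sCO [CA OA reachA]] e1 e2 eC; split=> //.
  rewrite cat_cons simple_edges_cons sCO andbT !mem_cat !negb_or eC /=.
  have -> : e.1 != e.2 by apply: contraNneq e2 => <-.
  have -> : e \notin O by apply/negP => /OA[_]; rewrite (negbTE e2).
  have -> : edge_swap e \notin C by apply/negP => /CA /=; rewrite (negbTE e2).
  by apply/negP => /OA[/=]; rewrite (negbTE e2).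
split=> //; first by move=> f; rewrite inE => /predU1P[->|/CA].
by move=> t; rewrite edges_state_closed => -[]; auto.
Qed.

Lemma exploration_open A C O e : exploration A C O ->
  e.1 \in A -> e.2 \notin A -> e \notin C -> exploration (e.2 :: A) C (e :: O).
Proof.
move=> ex e1 e2 eC; have [_ _ seCO _] := exploration_closed ex e1 e2 eC.
have [uA sA _ [CA OA reachA]] := ex; split=> /=; rewrite ?e2 ?sA//.
  by rewrite (simple_edges_perm (t := e :: C ++ O))// -(cat1s e O) perm_catCA.
split.
- by move=> f /CA fA; rewrite inE fA orbT.
- move=> f; rewrite inE => /predU1P[->|/OA[f1 f2]].
    by rewrite !inE eqxx e1 orbT.
  by rewrite !inE f1 f2 !orbT.
move=> t; rewrite edges_state_open => -[st ne] a; rewrite inE => /predU1P[->|]; last exact: reachA.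
apply: reach_step (reachA t st _ e1) _; split.
  by move=> e12; rewrite -e12 e1 in e2.
by rewrite lt0n; apply/eqP.
Qed.

(* The chance of seeing a given exploration is compared with its chance when
   the edge probability [p e] is replaced by [open_tilt e]; the two agree up to
   the factor [x] once the whole boundary of [A] is closed. *)
Lemma exploration_bound n A C O : exploration A C O ->
  (P (edges_state N C O `&` confined n) <=
   (x * \prod_(e <- C) closed_tilt e * \prod_(e <- O) open_tilt e)%:E)%E.
Proof.
(* Two nested inductions: outside on the vertices still to be found before exceeding [n], inside on
   the unexamined boundary edges. An open edge lowers the first count, a closed one the second. *)
move: {2}(n.+1 - size A)%N (leqnn (n.+1 - size A)) => k.
elim: k A C O => [|k IHk] A C O.
  rewrite leqn0 subn_eq0 => nA ex; have [uA _ _ [_ _ reachA]] := ex.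
  rewrite (_ : _ `&` _ = set0).
    rewrite measure0 lee_fin; apply: mulr_ge0; last exact: prodr_ge0.
    by apply: mulr_ge0; [exact: ltW|exact: prodr_ge0].
  apply/seteqP; split=> // t [st cf]; have : (n < size A)%N by [].
  rewrite ltnNge => /negP; apply; rewrite -(size_map code) -(size_iota 0 n).
  apply: uniq_leq_size; first by rewrite map_inj_uniq//; exact: can_inj codeK.
  move=> j /mapP[a aA ->]; rewrite mem_iota add0n /= ltnNge; apply/negP => na.
  apply: cf; exists (code a) => //; split; rewrite codeK//.
  exact: reachA st a aA.
move=> nA.
move: {2}(count (fun e => e \notin C) (edge_boundary Z A))
  (leqnn (count (fun e => e \notin C) (edge_boundary Z A))) => m.
elim: m C => [|m IHm] C Cm ex; last first.
  have [/hasP[e eA eC]|] := boolP (has (fun e => e \notin C) (edge_boundary Z A)); last first.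
    rewrite has_count -leqNgt leqn0 => /eqP C0; apply: IHm => //.
    by rewrite C0.
  have /andP[e1 e2] := mem_edge_boundary eA.
  have exC := exploration_closed ex e1 e2 eC.
  have exO := exploration_open ex e1 e2 eC.
  have -> : edges_state N C O `&` confined n =
      (edges_state N (e :: C) O `&` confined n) `|`
      (edges_state N C (e :: O) `&` confined n).
    rewrite edges_state_closed edges_state_open -setIUl; congr (_ `&` _).
    by rewrite setUC setDE -setIUr setvU setIT.
  apply: le_trans (measureU2 _ _ _) _.
    by apply: measurableI; [exact: (edges_state_measurable PM)|exact: confined_measurable].
    by apply: measurableI; [exact: (edges_state_measurable PM)|exact: confined_measurable].
  have hC : (count (fun f => f \notin e :: C) (edge_boundary Z A) <= m)%N.
    pose r := [seq f <- edge_boundary Z A | f \notin C].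
    have ur : uniq r by apply: filter_uniq; apply: edge_boundary_uniq; case: ex.
    have er : e \in r by rewrite mem_filter eC.
    have rm : ((size r).-1 <= m)%N by rewrite /r size_filter; move: Cm; case: (count _ _).
    apply: leq_trans rm; rewrite -(size_rem er) -size_filter.
    apply: uniq_leq_size; first by apply: filter_uniq; apply: edge_boundary_uniq; case: ex.
    move=> f; rewrite mem_filter inE negb_or => /andP[/andP[fe fC] fA].
    by rewrite (mem_rem_uniq e ur) inE /= fe mem_filter fC.
  have hO : (n.+1 - size (e.2 :: A) <= k)%N by rewrite /=; lia.
  apply: le_trans (leeD (IHm _ hC exC) (IHk _ _ _ hO exO)) _.
  rewrite -EFinD lee_fin !big_cons.
  set a := \prod_(_ <- C) _; set b := \prod_(_ <- O) _.
  (* The bound is exactly additive over the two outcomes because the tilted probabilities of [e] sum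
     to 1. *)
  rewrite -[leRHS]mul1r -(tilt_sum e) le_eqVlt; apply/orP; left; apply/eqP.
  by rewrite -/a -/b; ring.
have [uA sA sCO _] := ex.
apply: (@le_trans _ _ (P (edges_state N C O))).
  apply: le_measure; rewrite ?inE; [|exact: (edges_state_measurable PM)|by move=> t []].
  by apply: measurableI; [exact: (edges_state_measurable PM)|exact: confined_measurable].
rewrite (edges_state_prob PM)// lee_fin /closed_tilt /open_tilt.
under [X in x * X]eq_bigr => e _ do rewrite mulrC.
rewrite !big_split /= prodfV prodfV.
rewrite big_const_seq count_predT iter_mulr_1 -/p.
have uCO : uniq (C ++ O) by move: sCO; rewrite /simple_edges cat_uniq => /andP[].
(* The boundary is now entirely closed. Untilting costs the product of [q] over [C ++ O] divided by
   x^|O|. That product is at most x^|A|, and |A| = |O| + 1 leaves the factor [x]. *)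
have bC : {subset edge_boundary Z A <= C ++ O}.
  move=> e eA; rewrite mem_cat; apply/orP; left; apply: contraLR Cm => eC.
  by rewrite -ltnNge -has_count; apply/hasP; exists e.
have := le_trans (prod_q_le uCO (edge_boundary_uniq uZ uA) bC) (boundary uA).
rewrite big_cat /= sA exprS.
set a := \prod_(_ <- C) _; set b := \prod_(_ <- O) _.
have a0 : 0 < a by apply: prodr_gt0 => e _; exact: q0.
have b0 : 0 < b by apply: prodr_gt0 => e _; exact: q0.
set c := \prod_(_ <- C) _; set o := \prod_(_ <- O) _.
have c0 : 0 <= c by apply: prodr_ge0 => e _; rewrite subr_ge0 ltW.
have o0 : 0 <= o by apply: prodr_ge0 => e _; exact: p0.
move=> abx.
have -> : x * (a^-1 * c) * (x ^+ size O * o / b) = (c * o) * ((x * x ^+ size O) / (a * b)).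
  by field; rewrite !lt0r_neq0.
by rewrite ler_peMr ?mulr_ge0// ler_pdivlMr ?mulr_gt0// mul1r.
Qed.

(** Starting from the single vertex [v], the bound says that [confined n] has probability at most
    [x], uniformly in [n]; then n tends to infinity. *)
Lemma infinite_cluster_prob : ((1 - x)%:E <= P (lim_sup_set (reach_code N code dec v)))%E.
Proof.
have mF j := reach_code_measurable PM codeK v j.
have mU n : measurable (\bigcup_(j >= n) reach_code N code dec v j).
  by apply: bigcup_measurable => j _; exact: mF.
have finP A : measurable A -> P A \is a fin_num by exact: fin_num_measure.
have /cvg_lim <- // : P (\bigcup_(j >= n) reach_code N code dec v j) @[n --> \oo] -->
    P (lim_sup_set (reach_code N code dec v)).
  apply: lim_sup_set_cvg => //.
  by apply: le_lt_trans (probability_le1 P (mU 0%N)) _; rewrite ltry.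
apply: lime_ge.
  apply/cvg_ex; eexists; apply: lim_sup_set_cvg => //.
  by apply: le_lt_trans (probability_le1 P (mU 0%N)) _; rewrite ltry.
apply: nearW => n.
have ex : exploration [:: v] [::] [::].
  split=> //; split=> [e|e|t _ a]; rewrite ?in_nil// inE => /eqP ->.
  exact: reach_refl.
have := exploration_bound n ex.
have -> : edges_state N [::] [::] `&` confined n = confined n.
  apply/seteqP; split=> [t []//|t ct].
  by split=> //; split=> e; rewrite in_nil.
rewrite !big_nil !mulr1 /confined probability_setC//.
rewrite leeBlDr ?finP// -leeBlDl//.
Qed.

End exploration.

(** * Percolation above 1 from the isoperimetric inequality *)

(** From 1 - exp(-w) >= w / (1 + w): when [mu] is uniformly small, parallel edges are rare and the
    open probability is nearly linear in [mu]. *)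
Lemma edge_prob_ge (R : realType) (G : groupType) (mu : G -> R) (l0 l del : R) e :
  (forall g, 0 <= mu g <= del) -> 0 <= l0 <= l ->
  l0 / (1 + l0 * del) * mu (e.1^-1 * e.2)%g <= edge_prob mu l e.
Proof.
move=> mudel /andP[l00 l0l]; rewrite /edge_prob; set m := mu _.
have /andP[m0 md] : 0 <= m <= del by exact: mudel.
have w0 : 0 <= l0 * m by rewrite mulr_ge0.
have wd : l0 * m <= l0 * del by rewrite ler_wpM2l.
have h1 : expR (- (l * m)) <= (1 + l0 * m)^-1.
  rewrite expRN lef_pV2 ?posrE ?expR_gt0 ?ltr_wpDr//.
  apply: le_trans (expR_ge1Dx _); rewrite lerD2l ler_wpM2r//.
have h2 : l0 / (1 + l0 * del) * m <= l0 * m / (1 + l0 * m).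
  rewrite mulrAC ler_wpM2l// lef_pV2 ?posrE ?lerD2l// ltr_wpDr//.
  exact: le_trans wd.
have h3 : l0 * m / (1 + l0 * m) = 1 - (1 + l0 * m)^-1.
  by field; rewrite gt_eqF// ltr_wpDr.
lra.
Qed.

(** Each vertex of [K] emits mass 1, and [pairs] bounds the total mass that lands back in [K]. *)
Lemma edge_boundary_weight (R : realType) (G : groupType) (mu : G -> R)
    (Z K : seq G) (del : R) :
  (forall g, 0 <= mu g) -> uniq Z -> \sum_(z <- Z) mu z = 1 -> uniq K ->
  \sum_(g <- K) \sum_(h <- K) mu (g^-1 * h)%g <= del * (size K)%:R ->
  (1 - del) * (size K)%:R <= \sum_(e <- edge_boundary Z K) mu (e.1^-1 * e.2)%g.
Proof.
move=> mu0 uZ Z1 uK pairs; rewrite big_filter big_mkcond big_allpairs_dep /=.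
have inner g : 1 - \sum_(h <- K) mu (g^-1 * h)%g <=
    \sum_(z <- Z) (if (g * z)%g \notin K then mu (g^-1 * (g * z))%g else 0).
  rewrite -Z1 (bigID (fun z => (g * z)%g \in K))/= addrC lerBlDr.
  rewrite [X in _ <= X + _](eq_bigr (fun z => if (g * z)%g \notin K then mu z else 0)).
    rewrite -big_mkcond /= lerD2l.
    rewrite -big_filter (eq_bigr (fun z => mu (g^-1 * (g * z))%g)); last first.
      by move=> z _; rewrite mulKg.
    rewrite -(big_map (fun z => (g * z)%g) xpredT (fun h => mu (g^-1 * h)%g)).
    set D := [seq _ | _ <- _].
    have uD : uniq D by rewrite map_inj_uniq ?filter_uniq//; exact: mulgI.
    have DK : {subset D <= K}.
      by move=> h /mapP[z]; rewrite mem_filter => /andP[zK _] ->.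
    rewrite [leRHS](bigID (mem D))/= -[X in X + _]big_filter.
    rewrite [X in _ <= X + _](perm_big D) ?lerDl ?sumr_ge0//.
    apply: uniq_perm => //; first exact: filter_uniq.
    by move=> h; rewrite mem_filter; case hD : (h \in D) => //=; exact: DK.
  by move=> z _; rewrite mulKg.
apply: le_trans (ler_sum _ (fun g _ => inner g)).
by rewrite sumrB sumr_cst_seq mulr1; lra.
Qed.

Lemma lambda_c_le (R : realType) (G : groupType) (S : seq G) (mu : G -> R)
    (l0 del : R) : generates S -> sym_prob mu -> fsup mu ->
  (forall g, mu g <= del) ->
  (forall K : seq G, uniq K ->
    \sum_(g <- K) \sum_(h <- K) mu (g^-1 * h)%g <= del * (size K)%:R) ->
  0 <= l0 -> 1 + l0 * del < l0 * (1 - del) ->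
  (lambda_c mu <= l0%:E)%E.
Proof.
move=> gS mu_prob [s0 mus] mudel pairs l00 gap.
have [mu0 mu1 _] := mu_prob; have [code [dec codeK]] := generates_code gS.
apply: ge_ereal_sup => _ [l [lpos nul] <-]; rewrite lee_fin leNgt; apply/negP => l0l.
pose Z := undup s0; have uZ : uniq Z by exact: undup_uniq.
have Z1 : \sum_(z <- Z) mu z = 1.
  have muZ x : x \notin Z -> mu x = 0 by rewrite mem_undup; exact: mus.
  have : fsup mu by exists s0.
  by rewrite -(gsumE uZ muZ) => /esum_fsup/(_ mu0); rewrite mu1 => -[].
have del0 : 0 <= del by exact: le_trans (mu0 1%g) (mudel _).
have den : 0 < 1 + l0 * del by rewrite ltr_wpDr// mulr_ge0.
(* A lower bound, per vertex of K, for the mean number of open boundary edges; the gap hypothesis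
   says that it exceeds 1. *)
pose a := l0 / (1 + l0 * del) * (1 - del).
have a1 : 1 < a by rewrite /a mulrAC ltr_pdivlMr// mul1r.
have a0 : 0 < a by exact: lt_trans a1.
(* Then exp(-(1 - x) a) = exp(-(a - 1)) <= 1/a = x, because exp(a - 1) >= a. *)
pose x := a^-1.
have x0 : 0 < x by rewrite invr_gt0.
have x1 : x < 1 by rewrite invf_lt1.
have p01 e : 0 <= edge_prob mu l e by have /andP[] := edge_prob_bounds e mu0 (ltW lpos).
have boundary (K : seq G) : uniq K ->
    \prod_(e <- edge_boundary Z K) (1 - (1 - x) * edge_prob mu l e) <= x ^+ size K.
  move=> uK.
  have q0 e : 0 <= 1 - (1 - x) * edge_prob mu l e.
    have e1 : edge_prob mu l e <= 1 by rewrite /edge_prob gerBl expR_ge0.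
    rewrite subr_ge0; apply: (@le_trans _ _ (1 * 1)); last by rewrite mulr1.
    by apply: ler_pM => //; [rewrite subr_ge0 ltW|rewrite gerBl ltW].
  apply: (@le_trans _ _ (\prod_(e <- edge_boundary Z K) expR (- ((1 - x) * edge_prob mu l e)))).
    by apply: ler_prod => e _; rewrite q0 expR_ge1Dx.
  rewrite -expR_sum sumrN -mulr_sumr.
  have sum_ge : a * (size K)%:R <= \sum_(e <- edge_boundary Z K) edge_prob mu l e.
    apply: (@le_trans _ _ (l0 / (1 + l0 * del) *
        \sum_(e <- edge_boundary Z K) mu (e.1^-1 * e.2)%g)).
      rewrite /a -mulrA; apply: ler_wpM2l; first by rewrite divr_ge0// ltW.
      exact: edge_boundary_weight (pairs K uK).
    rewrite mulr_sumr; apply: ler_sum => e _; apply: edge_prob_ge.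
      by move=> g; rewrite mu0 mudel.
    by rewrite l00 ltW.
  apply: (@le_trans _ _ (expR (- (a - 1) * (size K)%:R))).
    rewrite ler_expR mulNr lerN2.
    have -> : (a - 1) * (size K)%:R = (1 - x) * (a * (size K)%:R).
      by rewrite /x; field; exact: lt0r_neq0.
    by apply: ler_wpM2l => //; rewrite subr_ge0 ltW.
  rewrite expRM_natr.
  apply: lerXn2r; rewrite ?nnegrE ?expR_ge0 ?(ltW x0)//.
  rewrite expRN lef_pV2 ?posrE ?expR_gt0//.
  by have := expR_ge1Dx (a - 1); rewrite addrC subrK.
have [d [T [P [N PM]]]] := poisson_multigraph_exists gS mu_prob (ltW lpos).
have := infinite_cluster_prob PM mu0 (ltW lpos) uZ codeK x0 x1 boundary 1%g.
have -> : P (lim_sup_set (reach_code N code dec 1%g)) = 0%E.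
  have := nul d T P N PM; rewrite (infinite_componentE N codeK).
  have mL v := infinite_cluster_measurable PM codeK v.
  apply: subset_measure0 => //; first exact: bigcupT_measurable.
  by move=> t ?; exists (code 1%g); rewrite // codeK.
by rewrite lee_fin subr_le0 leNgt x1.
Qed.

Theorem theorem6 (R : realType) (G : groupType) (S : seq G) :
  generates S -> ~ amenable R G -> epdim R S = 1%R.
Proof.
move=> gS nA; have [r r01 small] := small_isoperimetric_measures gS nA.
pose E := [set s : R | 0 < s <= 1 /\ exists r : R, 0 < r < 1 /\
  ereal_inf [set lambda_c mu | mu in eM S r s] = 1%E].
have E1 : E 1.
  split; first by rewrite ltr01 lexx.
  exists r; split=> //; apply/eqP; rewrite eq_le; apply/andP; split; last first.
    apply: le_ereal_inf_tmp => _ [mu [mu_prob _] <-].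
    exact: lambda_c_ge1 gS mu_prob.
  apply/lee_addgt0Pr => e e0.
  (* With l0 = 1 + e this gives l0 del = e/4, and the gap condition becomes 1 + e/4 < 1 + e -
     e/4. *)
  pose del := e / (4 * (1 + e)).
  have del0 : 0 < del by rewrite divr_gt0// mulr_gt0// addr_gt0.
  have [mu [mueM fmu mudel pairs]] := small del del0.
  apply: (@le_trans _ _ (lambda_c mu)); first by apply: ereal_inf_lbound; exists mu.
  rewrite -EFinD; have [mu_prob _] := mueM.
  apply: (lambda_c_le gS mu_prob fmu mudel pairs); first by rewrite addr_ge0// ltW.
  have e1 : (1 + e) * del = e / 4 by rewrite /del; field; rewrite lt0r_neq0// addr_gt0.
  by rewrite mulrBr e1; lra.
have ubE : ubound E 1 by move=> s [/andP[]].
apply/eqP; rewrite eq_le; apply/andP; split.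
  by apply: ge_sup => //; exists 1.
by apply: ub_le_sup => //; exists 1.
Qed.
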